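(* Let $p\in\mathbb{R}[x_1,\dots,x_m]$, let $U$ be a real $m\times n$ matrix with nonzero rows $u_1,\dots,u_m$, and suppose the star transform $\mathcal{S}=p(\mathcal{X}_{u_1},\dots,\mathcal{X}_{u_m})$ with symbol $(p,U)$ is realizable on $\mathbb{R}^n$. Then $\mathcal{S}$ is non-invertible if and only if the image of $U$ (as a linear map $\mathbb{R}^n\to\mathbb{R}^m$) is contained in the zero locus of $p^*$, i.e. $\mathrm{Im}(U)\subset V(p^* )(\mathbb{R})\subset\mathbb{A}^m(\mathbb{R})$. Moreover, if $\mathcal{S}$ has order $d$ (i.e. $p$ is homogeneous of degree $d$), then $\mathcal{S}$ is non-invertible if and only if the projective linear subspace $\mathbb{P}(\mathrm{Im}(U))\subset\mathbb{P}^{m-1}(\mathbb{R})$ is contained in $V(p^* )(\mathbb{R})\subset\mathbb{P}^{m-1}(\mathbb{R})$, the real points of the projective hypersurface defined by $p^*$. Furthermore, star transforms with symbols $(p,U)$ and $(p,U')$ (with $U,U'$ both $m\times n$) induce the same linear subset of $V(p^* )$ (i.e. $\mathrm{Im}(U)=\mathrm{Im}(U')$) if and only if $U'=Ug$ for some $g\in\mathrm{GL}_n(\mathbb{R})$.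
   Context: For $u\in\mathbb{R}^n\setminus\{0\}$, the divergent beam transform is $(\mathcal{X}_u f)(x)=\int_{-\infty}^{0} f(x+tu)\,dt$; these transforms commute. The star transform with symbol $(p,U)$ is $\mathcal{S}=p(\mathcal{X}_{u_1},\dots,\mathcal{X}_{u_m})$ (products meaning composition), where $u_1,\dots,u_m$ are the rows of $U$. For polynomials of degree greater than $1$ the iterated integrals may diverge; $\mathcal{S}$ is realizable on $\mathbb{R}^n$ if no such divergence occurs, i.e. for all $f\in C_c^\infty(\mathbb{R}^n)$ the iterated integrals defining $\mathcal{S}f$ converge, so that $\mathcal{S}$ is a linear map $C_c^\infty(\mathbb{R}^n)\to C^\infty(\mathbb{R}^n)$. Non-invertible means that this map is not injective. The reciprocal polynomial (dual symbol) is $p^*(x_1,\dots,x_m)=x_1^{d_1}\cdots x_m^{d_m}\,p(x_1^{-1},\dots,x_m^{-1})$, where $d_j$ is the degree of $p$ in $x_j$; it is homogeneous when $p$ is. *)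

(* Defs.v *)
From HB Require Import structures.
From mathcomp Require Import all_boot all_order all_algebra.
From mathcomp Require Import all_classical all_reals all_analysis.
(* The notations of mpoly clash with those of mathcomp-analysis. *)
From mathcomp Require Export -(notations) mpoly.

Set Implicit Arguments.
Unset Strict Implicit.
Unset Printing Implicit Defensive.

Import Order.TTheory GRing.Theory Num.Theory.
Import numFieldNormedType.Exports.

Local Open Scope classical_set_scope.
Local Open Scope ring_scope.

Section SmoothFunctions.
Context {R : realType} {n : nat}.
Implicit Types f : 'cV[R]_n -> R.

Definition partial (i : 'I_n) f : 'cV[R]_n -> R := 'D_(delta_mx i ord0) f.

Definition iter_partial (s : seq 'I_n) f : 'cV[R]_n -> R := foldr partial f s.

(* C^oo: all iterated partial derivatives exist and are continuous. *)
Definition smooth f : Prop := forall s : seq 'I_n,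
  continuous (iter_partial s f) /\
  forall (i : 'I_n) (x : 'cV[R]_n),
    derivable (iter_partial s f) x (delta_mx i ord0).

Definition compactly_supported f : Prop := compact (closure [set x | f x != 0]).

Definition test_function : set ('cV[R]_n -> R) :=
  [set f | smooth f /\ compactly_supported f].

End SmoothFunctions.
Arguments test_function R n : clear implicits.

Section BeamTransform.
Context {R : realType} {n : nat}.
Implicit Types (u x : 'cV[R]_n) (f : 'cV[R]_n -> R) (s : seq 'cV[R]_n).

Definition beam_converges u f x : Prop :=
  (@lebesgue_measure R).-integrable `]-oo, 0%R] (fun t : R => (f (x + t *: u))%:E).

Definition beam u f : 'cV[R]_n -> R :=
  fun x => \int[lebesgue_measure]_(t in `]-oo, 0%R]) f (x + t *: u).

(* beam u_1 (beam u_2 (... (beam u_k f))) for s = [:: u_1; ...; u_k] *)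
Definition iter_beam s f : 'cV[R]_n -> R := foldr beam f s.

(* Every integral met when evaluating [iter_beam s f], from the innermost to
   the outermost, converges at every point. *)
Fixpoint iter_beam_converges s f : Prop :=
  if s is u :: s' then
    iter_beam_converges s' f /\ forall x, beam_converges u (iter_beam s' f) x
  else True.

End BeamTransform.

Section StarTransform.
Context {R : realType} {m n : nat}.
Implicit Types (p : mpoly m R) (U : 'M[R]_(m, n)) (a : multinom m).

(* The directions u_1 (a 1 times), ..., u_m (a m times), so that
   [iter_beam (monomial_dirs U a)] is X_{u_1}^{a 1} o ... o X_{u_m}^{a m}. *)
Definition monomial_dirs U a : seq 'cV[R]_n :=
  flatten [seq nseq (a j) (row j U)^T | j <- enum 'I_m].

Definition star p U (f : 'cV[R]_n -> R) : 'cV[R]_n -> R :=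
  fun x => \sum_(a <- msupp p) mcoeff a p * iter_beam (monomial_dirs U a) f x.

Definition realizable p U : Prop :=
  forall f, test_function R n f ->
  forall a, a \in msupp p -> iter_beam_converges (monomial_dirs U a) f.

Definition non_invertible p U : Prop :=
  ~ set_inj (test_function R n) (star p U).

(* Im(U), for U acting on column vectors *)
Definition image_mx U : set 'cV[R]_m := range (fun x : 'cV[R]_n => U *m x).

End StarTransform.

Section ReciprocalPolynomial.
Context {R : realType} {m : nat}.
Implicit Types (p : mpoly m R) (a : multinom m).

Definition degree_in (j : 'I_m) p : nat := \max_(a <- msupp p) a j.

(* x_1^{d_1} ... x_m^{d_m} p(1/x_1, ..., 1/x_m), expanded monomial by monomial;
   see [meval_reciprocal] *)
Definition reciprocal p : mpoly m R :=
  \sum_(a <- msupp p)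
    mcoeff a p *: mpolyX R (Multinom [tuple (degree_in j p - a j)%N | j < m]).

Lemma leq_degree_in p a j : a \in msupp p -> (a j <= degree_in j p)%N.
Proof. by move=> pa; rewrite /degree_in (big_rem a) //= leq_maxl. Qed.

Lemma meval_reciprocal p (x : 'I_m -> R) : (forall j, x j != 0) ->
  meval x (reciprocal p) =
  (\prod_j x j ^+ degree_in j p) * meval (fun j => (x j)^-1) p.
Proof.
move=> x0; rewrite /reciprocal raddf_sum /= mevalE big_distrr /=.
apply: eq_big_seq => a pa; rewrite mevalZ mevalX mulrCA; congr (_ * _).
rewrite -big_split; apply: eq_bigr => j _ /=.
by rewrite multinomE tnth_mktuple exprVn expfB_cond // (negPf (x0 j)) leq_degree_in.
Qed.

End ReciprocalPolynomial.

Section ZeroLoci.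
Context {R : realType} {m : nat}.
Implicit Types (q : mpoly m R) (W : set 'cV[R]_m).

Definition eval_at q (y : 'cV[R]_m) : R := meval (fun j => y j ord0) q.

(* V(q)(R) in A^m(R) *)
Definition zero_locus q : set 'cV[R]_m := [set y | eval_at q y = 0].

(* P^{m-1}(R), the set of lines through the origin in R^m *)
Definition proj_space : Type := {L : {vspace 'cV[R]_m} | \dim L = 1%N}.

Definition proj_linear W : set proj_space :=
  [set L : proj_space | [set` sval L] `<=` W].

(* V(q)(R) in P^{m-1}(R); meant for homogeneous q, for which the vanishing of q
   at a point does not depend on the nonzero representative y *)
Definition proj_zero_locus q : set proj_space :=
  [set L : proj_space | forall y : 'cV[R]_m, y \in sval L -> y != 0 -> eval_at q y = 0].

End ZeroLoci.

(* Main.v *)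
(* Write [D_u] for the directional derivative, so that [X_u D_u g = g] for a test
   function [g], and [d_j] for the degree of [p] in [x_j].  Hence [S] applied to
   [D_1^{d_1} ... D_m^{d_m} g] is [p^*(D_1, ..., D_m) g], a constant coefficient
   operator whose symbol is the polynomial [p^* o U].

   If [p^* o U = 0], this produces nonzero elements of the kernel of [S].
   Conversely, let [S h = 0].  Realizability and dominated convergence make [S]
   commute with derivations on test functions, so that [p^*(D_1, ..., D_m) h = 0],
   and a nonzero constant coefficient operator is injective on test functions:
   by Hoermander's commutator argument, if it kills [h] then so do all the
   operators whose symbols are partial derivatives of its symbol, down to a
   nonzero constant.  The [L^2] product used there is only needed up to functions
   whose Riemann sums over a large cube tend to [0]. *)
Require Import Defs.
From HB Require Import structures.
From mathcomp Require Import all_boot all_order all_algebra.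
From mathcomp Require Import all_classical all_reals all_analysis.
From mathcomp Require Import ring lra.
Import Order.TTheory GRing.Theory Num.Theory.
Import numFieldNormedType.Exports.
Local Open Scope classical_set_scope.
Local Open Scope ring_scope.

Set Implicit Arguments.
Unset Strict Implicit.
Unset Printing Implicit Defensive.

(** Beam transforms do not preserve compact support, while realizability speaks only of test
    functions. A limit therefore passes under the iterated integrals of S only when the dominating
    function is itself a test function, whence the explicit bump functions of prescribed height. The
    kernel elements produced when p^* o U = 0 are nonzero because the beams along the same
    directions give [g] back. In the commutator argument, the mean replacing the integral needs only
    three properties: linearity, vanishing on partial derivatives of test functions, and
    definiteness on nonnegative ones. Means over finer and finer grids of a cube have them by
    elementary estimates, without iterated integration in dimension n. *)

(** * Directional derivatives along lines *)

Section Lines.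
Context {R : realType} {V : normedModType R}.
Implicit Types (f : V -> R) (x u v : V).

Lemma is_derive_line f x u (t : R) : derivable f (x + t *: u) u ->
  is_derive t 1 (fun s => f (x + s *: u)) ('D_u f (x + t *: u)).
Proof.
move=> df; have E : (fun h : R => h^-1 *: (((fun s => f (x + s *: u)) \o shift t) (h *: 1)
      - f (x + t *: u))) =
    (fun h : R => h^-1 *: ((f \o shift (x + t *: u)) (h *: u) - f (x + t *: u))).
  apply/funext => h /=; congr (_ *: (f _ - _)).
  by rewrite [h%:A]mulr1 scalerDl addrCA.
by split; rewrite /derivable /derive E.
Qed.

(** Bounding the intermediate point by [|h|], instead of placing it in an oriented interval, covers
    both signs of [h] and [h = 0] at once. *)
Lemma line_mvt f x u (h : R) : (forall y, derivable f y u) ->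
  exists2 c : R, `|c| <= `|h| & f (x + h *: u) - f x = h * 'D_u f (x + c *: u).
Proof.
move=> df; have D t := is_derive_line (df (x + t *: u)).
have C (A : set R) : {within A, continuous (fun s : R => f (x + s *: u))}.
  apply: continuous_subspaceT => t; apply: differentiable_continuous.
  by apply/derivable1_diffP; exact: (@ex_derive _ _ _ _ _ _ _ (D t)).
have [h0|h0|->] := ltgtP h 0.
- have [c ci E] := MVT h0 (fun t _ => D t) (C _).
  exists c; first by rewrite !ltr0_norm ?(itvP ci)// lerN2 ltW ?(itvP ci).
  by move: E; rewrite scale0r addr0 => E; rewrite -opprB E sub0r mulrN opprK mulrC.
- have [c ci E] := MVT h0 (fun t _ => D t) (C _).
  exists c; first by rewrite !gtr0_norm ?(itvP ci)// ltW ?(itvP ci).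
  by move: E; rewrite scale0r addr0 => ->; rewrite subr0 mulrC.
- by exists 0; rewrite ?normr0// !scale0r addr0 subrr mul0r.
Qed.

(* Increment first along [v], then along [u]: continuity of ['D_v f] absorbs the
   shift of the base point in the second increment. *)
Lemma is_deriveD_dir f x u v (du : R) : is_derive x u f du ->
  (forall y, derivable f y v) -> {for x, continuous ('D_v f)} ->
  is_derive x (u + v) f (du + 'D_v f x).
Proof.
move=> [fu <-] fv cv.
suff L : h^-1 *: ((f \o shift x) (h *: (u + v)) - f x) @[h --> 0^']
    --> 'D_u f x + 'D_v f x.
  by split; [apply/cvg_ex; eexists; exact: L|exact: cvg_lim L].
have /choice[c cP] : forall h : R, exists c, `|c| <= `|h| /\
    f (x + h *: u + h *: v) - f (x + h *: u) = h * 'D_v f (x + h *: u + c *: v).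
  by move=> h; have [c] := line_mvt (x + h *: u) h fv; exists c.
have near0 : \forall h \near (0 : R)^', h^-1 *: ((f \o shift x) (h *: u) - f x)
    + 'D_v f (x + h *: u + c h *: v) =
    h^-1 *: ((f \o shift x) (h *: (u + v)) - f x).
  near=> h; have h0 : h != 0 by near: h; exact: nbhs_dnbhs_neq.
  have [_ E] := cP h; rewrite /= (addrC (h *: u)) (addrC (h *: (u + v))) (scalerDr h) addrA.
  have -> : f (x + h *: u + h *: v) - f x =
      h * 'D_v f (x + h *: u + c h *: v) + (f (x + h *: u) - f x).
    by rewrite -E addrA subrK.
  by rewrite [RHS]scalerDr [h^-1 *: (h * _)]mulrA mulVf// mul1r [RHS]addrC.
have cc : c h @[h --> (0 : R)^'] --> (0 : R).
  apply/cvgr0Pnorm_le => e e0; near=> h.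
  apply: (le_trans (cP h).1); near: h.
  by apply: dnbhs0_le.
have c0 : x + h *: u + c h *: v @[h --> (0 : R)^'] --> x.
  have -> : nbhs x = nbhs (x + 0 *: u + 0 *: v) by rewrite !scale0r !addr0.
  apply: cvgD; [apply: cvgD|]; [exact: cvg_cst| |].
    by apply: cvgZr_tmp; apply: cvg_within.
  exact: cvgZr_tmp.
apply: cvg_trans; first by apply: near_eq_cvg; exact: near0.
by apply: cvgD; [exact: fu|exact: (cvg_comp _ _ c0 cv)].
Unshelve. all: by end_near. Qed.

Lemma is_deriveZ_dir f x u (a du : R) : is_derive x u f du ->
  is_derive x (a *: u) f (a * du).
Proof.
move=> [fu <-]; have [->|a0] := eqVneq a 0.
  by rewrite scale0r mul0r; exact: is_derive0.
suff L : h^-1 *: ((f \o shift x) (h *: (a *: u)) - f x) @[h --> 0^']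
    --> a * 'D_u f x.
  by split; [apply/cvg_ex; eexists; exact: L|exact: cvg_lim L].
have -> : (fun h => h^-1 *: ((f \o shift x) (h *: (a *: u)) - f x)) =
    (fun h => a *: (h^-1 *: ((f \o shift x) (h *: u) - f x))) \o *%R^~ a.
  apply/funext => h /=; have [->|h0] := eqVneq h 0.
    by rewrite mul0r !scale0r add0r subrr !scaler0.
  by rewrite !scalerA invfM mulrCA mulfV// mulr1.
apply: (@cvg_comp _ _ _ _ _ _ (0^')); last first.
  by apply: cvgZl_tmp; exact: fu.
move=> P /= P0; have := @near0Z R R^o a _ P0.
rewrite /dnbhs /fmap /within /=; apply: filterS => h H h0.
by apply: H; rewrite mulf_neq0.
Qed.

(* The second difference of [f] along [u], [v] at scale [h] equals both
   [h^2 'D_v 'D_u f] and [h^2 'D_u 'D_v f] at points within [O(h)] of [x]. *)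
Lemma derive_comm f u v x :
  (forall y, derivable f y u) -> (forall y, derivable f y v) ->
  (forall y, derivable ('D_u f) y v) -> (forall y, derivable ('D_v f) y u) ->
  continuous ('D_v ('D_u f)) -> continuous ('D_u ('D_v f)) ->
  'D_v ('D_u f) x = 'D_u ('D_v f) x.
Proof.
have second u' v' : (forall y, derivable f y u') ->
    (forall y, derivable ('D_u' f) y v') -> forall h : R, exists c : R * R,
    [/\ `|c.1| <= `|h|, `|c.2| <= `|h| &
      f (x + h *: u' + h *: v') - f (x + h *: u') - f (x + h *: v') + f x =
      h ^+ 2 * 'D_v' ('D_u' f) (x + c.1 *: u' + c.2 *: v')].
  move=> fu fuv h.
  have D y : is_derive y u' (f \o shift (h *: v') - f)
      ('D_u' f (y + h *: v') - 'D_u' f y).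
    have S : is_derive y u' (f \o shift (h *: v')) ('D_u' f (y + h *: v')).
      have E : (fun k : R => k^-1 *: (((f \o shift (h *: v')) \o shift y) (k *: u')
          - f (y + h *: v'))) =
          (fun k : R => k^-1 *: ((f \o shift (y + h *: v')) (k *: u') - f (y + h *: v'))).
        by apply/funext => k /=; rewrite addrA.
      by split; rewrite /derivable /derive E//; exact: fu.
    by apply: is_deriveB; exact/derivableP.
  have [a ah Ea] := @line_mvt (f \o shift (h *: v') - f) x u' h
    (fun y => @ex_derive _ _ _ _ _ _ _ (D y)).
  have [b bh Eb] := line_mvt (x + a *: u') h fuv.
  exists (a, b); split => //=.
  rewrite expr2 -mulrA -Eb.
  move: Ea; rewrite (@derive_val _ _ _ _ _ _ _ (D (x + a *: u'))) => <-.
  by rewrite /= !fctE /=; ring.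
move=> fu fv fuv fvu cuv cvu.
have /choice[c cP] := second _ _ fu fuv.
have /choice[d dP] := second _ _ fv fvu.
have lim2 (e : R -> R * R) u' v' :
    (forall h, `|(e h).1| <= `|h| /\ `|(e h).2| <= `|h|) ->
    continuous ('D_v' ('D_u' f)) ->
    'D_v' ('D_u' f) (x + (e h).1 *: u' + (e h).2 *: v') @[h --> (0 : R)^']
    --> 'D_v' ('D_u' f) x.
  move=> eh cf.
  have e0 (k : R -> R) : (forall h, `|k h| <= `|h|) -> k h @[h --> (0 : R)^'] --> (0 : R).
    move=> kh; apply/cvgr0Pnorm_le => r r0; near=> h.
    by apply: (le_trans (kh h)); near: h; apply: dnbhs0_le.
  have ex : x + (e h).1 *: u' + (e h).2 *: v' @[h --> (0 : R)^'] --> x.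
    have -> : nbhs x = nbhs (x + 0 *: u' + 0 *: v') by rewrite !scale0r !addr0.
    by apply: cvgD; [apply: cvgD|]; [exact: cvg_cst| |];
      apply: cvgZr_tmp; apply: e0 => h; case: (eh h).
  exact: (cvg_comp _ _ ex (cf x)).
have lc := lim2 c u v (fun h => let: And3 a b _ := cP h in conj a b) cuv.
have ld := lim2 d v u (fun h => let: And3 a b _ := dP h in conj a b) cvu.
have lE := cvg_lim (@Rhausdorff R) lc; rewrite -lE.
apply: cvg_lim; first exact: Rhausdorff.
apply: cvg_trans ld; apply: near_eq_cvg.
near=> h; have h0 : h != 0 by near: h; exact: nbhs_dnbhs_neq.
have [_ _ E1] := cP h; have [_ _ E2] := dP h.
apply: (@mulfI _ (h ^+ 2)); first by rewrite expf_neq0.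
apply: etrans E1; apply: etrans (esym E2) _.
rewrite (_ : x + h *: u + h *: v = x + h *: v + h *: u); last exact: addrAC.
by congr (_ + _); exact: addrAC.
Unshelve. all: by end_near. Qed.

End Lines.

(** * Smooth functions and test functions *)

Section Smooth.
Context {R : realType} {n : nat}.
Implicit Types (f g : 'cV[R]_n -> R) (x u v : 'cV[R]_n).

Local Notation basis i := (delta_mx i ord0 : 'cV[R]_n).

(** The Leibniz rule turns an iterated partial derivative of a product into a sum of products, so
    [smooth], stated word by word, is awkward for induction. Finite orders of differentiability are
    stable under sums and products by induction on [k]. *)
Fixpoint Ck (k : nat) f : Prop := continuous f /\
  if k is k'.+1 then
    forall i, (forall x, derivable f x (basis i)) /\ Ck k' (partial i f)
  else True.

Lemma smooth_partial i f : smooth f -> smooth (partial i f).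
Proof.
by move=> sf s; have := sf (rcons s i); rewrite /iter_partial -cats1 foldr_cat.
Qed.

Lemma smoothP f : smooth f <-> forall k, Ck k f.
Proof.
split=> [sf k|cf s].
  elim: k f sf => [|k IH] f sf /=; have [cf df] := sf [::]; split => // i.
  by split=> [x|]; [exact: df|apply: IH; exact: smooth_partial].
(* Words are consumed from the right: [foldr] applies the last letter first. *)
have : forall s k g, (forall k, Ck k g) -> Ck k (iter_partial s g).
  elim/last_ind => [|s' i IH] k g Hg /=; first exact: Hg.
  rewrite /iter_partial -cats1 foldr_cat; apply: IH => k'.
  by have [_ /(_ i)[]] := Hg k'.+1.
move=> /(_ s 1%N f cf) [c d]; split => // i x; exact: (d i).1.
Qed.

Lemma smooth_continuous f : smooth f -> continuous f.
Proof. by move=> /(_ [::])[]. Qed.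

Lemma smooth_derivable f i x : smooth f -> derivable f x (basis i).
Proof. by move=> /(_ [::])[_]; apply. Qed.

Lemma is_derive_partial f i x : smooth f ->
  is_derive x (basis i) f (partial i f x).
Proof. by move=> sf; apply/derivableP/smooth_derivable. Qed.

Lemma CkS k f : Ck k.+1 f -> Ck k f.
Proof.
elim: k f => [|k IH] f [cf df]; split => // i.
by split; [exact: (df i).1|apply: IH; exact: (df i).2].
Qed.

Lemma CkD k f g : Ck k f -> Ck k g -> Ck k (f + g).
Proof.
elim: k f g => [|k IH] f g [cf df] [cg dg]; split => //.
- by move=> x; apply: continuousD; [exact: cf|exact: cg].
- by move=> x; apply: continuousD; [exact: cf|exact: cg].
move=> i; have [fi fi'] := df i; have [gi gi'] := dg i.
split=> [x|]; first by apply: derivableD.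
rewrite (_ : partial i (f + g) = partial i f + partial i g); first exact: IH.
by apply/funext => x; rewrite /partial deriveD.
Qed.

Lemma CkM k f g : Ck k f -> Ck k g -> Ck k (f * g).
Proof.
elim: k f g => [|k IH] f g Hf Hg; have [cf df] := Hf; have [cg dg] := Hg; split => //.
- by move=> x; apply: continuousM; [exact: cf|exact: cg].
- by move=> x; apply: continuousM; [exact: cf|exact: cg].
move=> i; have [fi fi'] := df i; have [gi gi'] := dg i.
split=> [x|]; first by apply: derivableM.
rewrite (_ : partial i (f * g) = f * partial i g + g * partial i f); last first.
  by apply/funext => x; rewrite /partial deriveM.
by apply: CkD; apply: IH => //; exact: CkS.
Qed.

Lemma Ck_cst k (c : R) : Ck k (cst c).
Proof.
elim: k c => [|k IH] c; (split; first exact: cst_continuous) => // i.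
split=> [x|]; first exact: (derivable_cst c).
by rewrite (_ : partial i _ = cst 0)//; apply/funext => x; exact: derive_cst.
Qed.

Lemma smoothD f g : smooth f -> smooth g -> smooth (f + g).
Proof. by move=> /smoothP sf /smoothP sg; apply/smoothP => k; exact: CkD. Qed.

Lemma smoothM f g : smooth f -> smooth g -> smooth (f * g).
Proof. by move=> /smoothP sf /smoothP sg; apply/smoothP => k; exact: CkM. Qed.

Lemma smooth_cst (c : R) : smooth (cst c : 'cV[R]_n -> R).
Proof. by apply/smoothP => k; exact: Ck_cst. Qed.

Lemma smoothZ (c : R) f : smooth f -> smooth (c *: f).
Proof. exact: smoothM (smooth_cst c). Qed.

Lemma smooth_sum (I : Type) (r : seq I) (P : pred I) (F : I -> 'cV[R]_n -> R) :
  (forall i, P i -> smooth (F i)) -> smooth (\sum_(i <- r | P i) F i).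
Proof.
move=> sF.
have s0 : smooth (0 : 'cV[R]_n -> R) by rewrite (_ : 0 = cst 0); first exact: smooth_cst.
by apply: (big_ind smooth s0 smoothD).
Qed.

Lemma smooth_prod (I : Type) (r : seq I) (P : pred I) (F : I -> 'cV[R]_n -> R) :
  (forall i, P i -> smooth (F i)) -> smooth (\prod_(i <- r | P i) F i).
Proof.
move=> sF.
have s1 : smooth (1 : 'cV[R]_n -> R) by rewrite (_ : 1 = cst 1); first exact: smooth_cst.
by apply: (big_ind smooth s1 smoothM).
Qed.

Lemma partialD i f g : smooth f -> smooth g ->
  partial i (f + g) = partial i f + partial i g.
Proof.
by move=> sf sg; apply/funext => x; rewrite /partial deriveD//; exact: smooth_derivable.
Qed.

Lemma partialM i f g : smooth f -> smooth g ->
  partial i (f * g) = f * partial i g + g * partial i f.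
Proof.
by move=> sf sg; apply/funext => x; rewrite /partial deriveM//; exact: smooth_derivable.
Qed.

Lemma partialZ i (c : R) f : smooth f -> partial i (c *: f) = c *: partial i f.
Proof.
by move=> sf; apply/funext => x; rewrite /partial deriveZ//; exact: smooth_derivable.
Qed.

Lemma partial0 i : partial i (0 : 'cV[R]_n -> R) = 0.
Proof. by apply/funext => x; rewrite /partial derive_cst. Qed.

Lemma is_derive_coord u x (j : 'I_n) :
  is_derive x u (fun y : 'cV[R]_n => y j ord0) (u j ord0).
Proof.
have L : h^-1 *: (((fun y : 'cV[R]_n => y j ord0) \o shift x) (h *: u) - x j ord0)
    @[h --> (0 : R)^'] --> u j ord0.
  apply: cvg_near_cst; near=> h.
  rewrite /= !mxE addrK [_ *: _]mulrA mulVf ?mul1r//.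
  by near: h; exact: nbhs_dnbhs_neq.
by split; [apply/cvg_ex; eexists; exact: L|exact: cvg_lim L].
Unshelve. all: by end_near. Qed.

Lemma partial_coord i j :
  partial i (fun y : 'cV[R]_n => y j ord0) = cst (i == j)%:R.
Proof.
apply/funext => x; rewrite /partial.
by rewrite (@derive_val _ _ _ _ _ _ _ (is_derive_coord _ x j)) mxE eqxx andbT eq_sym.
Qed.

Lemma smooth_coord j : smooth (fun y : 'cV[R]_n => y j ord0).
Proof.
apply/smoothP => -[|k]; split => //; try exact: coord_continuous.
move=> i; split=> [x|]; last by rewrite partial_coord; exact: Ck_cst.
exact: (@ex_derive _ _ _ _ _ _ _ (is_derive_coord _ x j)).
Qed.

(** The direction is assembled one coordinate multiple at a time. Each addition requires only
    continuity of the derivative along the new coordinate, so total differentiability does not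
    enter. *)
Lemma is_derive_smooth f u x : smooth f ->
  is_derive x u f (\sum_i u i ord0 * partial i f x).
Proof.
move=> sf.
have dZ i (a : R) y : is_derive y (a *: basis i) f (a * partial i f y).
  by apply: is_deriveZ_dir; exact: is_derive_partial.
have {1}-> : u = \sum_i u i ord0 *: basis i.
  by rewrite [LHS]matrix_sum_delta; apply: eq_bigr => i _; rewrite big_ord1.
elim: (index_enum _) => [|i r IH].
  by rewrite !big_nil; exact: is_derive0.
rewrite !big_cons addrC [X in is_derive _ _ _ X]addrC.
have E : 'D_(u i ord0 *: basis i) f = u i ord0 *: partial i f.
  by apply/funext => y; rewrite (@derive_val _ _ _ _ _ _ _ (dZ i (u i ord0) y)).
rewrite -[_ * partial i f x]/((u i ord0 *: partial i f) x) -E.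
apply: (is_deriveD_dir IH).
  by move=> y; exact: (@ex_derive _ _ _ _ _ _ _ (dZ i (u i ord0) y)).
by rewrite E; apply: smooth_continuous; apply/smoothZ/smooth_partial.
Qed.

Lemma derive_smooth f u : smooth f ->
  'D_u f = \sum_i u i ord0 *: partial i f.
Proof.
move=> sf; apply/funext => x.
by rewrite (@derive_val _ _ _ _ _ _ _ (is_derive_smooth u x sf)) fct_sumE.
Qed.

Lemma derivable_smooth f u x : smooth f -> derivable f x u.
Proof. by move=> /(is_derive_smooth u x) H; exact: (@ex_derive _ _ _ _ _ _ _ H). Qed.

Lemma smooth_derive f u : smooth f -> smooth ('D_u f).
Proof.
move=> sf; rewrite (derive_smooth u sf); apply: smooth_sum => i _.
exact: smoothZ (smooth_partial i sf).
Qed.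

Lemma derive_smoothC f u v : smooth f -> 'D_v ('D_u f) = 'D_u ('D_v f).
Proof.
move=> sf; have du w := smooth_derive w sf; apply/funext => x.
apply: derive_comm.
- by move=> y; exact: (derivable_smooth sf).
- by move=> y; exact: (derivable_smooth sf).
- by move=> y; exact: (derivable_smooth (du u)).
- by move=> y; exact: (derivable_smooth (du v)).
- exact: smooth_continuous (smooth_derive v (du u)).
- exact: smooth_continuous (smooth_derive u (du v)).
Qed.

(** An explicit radius, for the maximum norm, replaces compactness of the support. Derivations and
    products keep it, so that one cube serves for all functions of the injectivity argument. *)
Definition supp_in (M : R) f : Prop := forall x, M < `|x| -> f x = 0.

Definition test_in (M : R) f : Prop := smooth f /\ supp_in M f.

Lemma coord_le_norm x i : `|x i ord0| <= `|x|.
Proof.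
rewrite [leRHS]/Num.Def.normr /= mx_normrE; apply/bigmax_geP; right => /=.
by exists (i, ord0).
Qed.

Lemma norm_leP x (M : R) : 0 <= M ->
  `|x| <= M <-> forall i, `|x i ord0| <= M.
Proof.
move=> M0; split=> [xM i|xM]; first exact: le_trans (coord_le_norm x i) xM.
rewrite [leLHS]/Num.Def.normr /= mx_normrE; apply/bigmax_leP; split => // -[i j] _ /=.
by rewrite ord1.
Qed.

Lemma norm_le_compact (M : R) :
  compact [set x : 'cV[R]_n | `|x| <= M].
Proof.
have [M0|M0] := ltP M 0.
  rewrite (_ : [set _ | _] = set0); first exact: compact0.
  by apply/seteqP; split => // x /= xM; move: (le_lt_trans xM M0); rewrite normr_lt0.
(* Products of compact segments are taken among row vectors; transposition, continuous for the
   maximum norm, carries the result to columns. *)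
pose B := [set v : 'rV[R]_n | forall i, v ord0 i \in `[- M, M]].
have cB : compact B.
  by apply: (@rV_compact _ _ (fun=> `[- M, M]%classic)) => _; exact: segment_compact.
have -> : [set x : 'cV[R]_n | `|x| <= M] = trmx @` B.
  apply/seteqP; split=> [x /= /(norm_leP _ M0) xM|_ [v vB <-]/=].
    exists x^T; last exact: trmxK.
    by move=> i; rewrite mxE in_itv /= -ler_norml.
  apply/norm_leP => // i; rewrite mxE ler_norml.
  by have := vB i; rewrite in_itv.
apply: continuous_compact cB; apply: continuous_subspaceT => v s.
move=> /(nbhs_ballP (v^T)) [e e0 es]; apply/nbhs_ballP; exists e => //= w [_ vw].
by apply: es; split => // i j; rewrite !mxE; exact: vw.
Qed.

Lemma supp_in_le (M M' : R) f : M <= M' -> supp_in M f -> supp_in M' f.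
Proof. by move=> MM fM x M'x; apply: fM; exact: le_lt_trans M'x. Qed.

Lemma supp_in_bounded (M : R) f : supp_in M f -> continuous f ->
  exists2 C, 0 <= C & forall x, `|f x| <= C.
Proof.
move=> fM cf.
have /compact_bounded[C [_ HC]] := continuous_compact
  (continuous_subspaceT cf) (@norm_le_compact M).
exists (Num.max 0 (C + 1)); first by rewrite le_max lexx.
move=> x; have [xM|/fM ->] := leP `|x| M; last by rewrite normr0 le_max lexx.
by rewrite le_max (HC (C + 1)) ?ltrDl ?orbT//; exists x.
Qed.

Lemma near_supp_in (M : R) f x : supp_in M f -> M < `|x| -> \near x, f x = 0.
Proof.
move=> fM Mx; near=> y; apply: fM; near: y.
have : `|y| @[y --> x] --> `|x| by exact: norm_continuous.
by move/cvgr_gt; exact.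
Unshelve. all: by end_near. Qed.

Lemma supp_in_derive (M : R) f u : supp_in M f -> supp_in M ('D_u f).
Proof.
move=> fM x Mx; rewrite -(derive_cst (0 : R) x u); apply: near_eq_derive.
exact: near_supp_in Mx.
Qed.

Lemma test_in_continuous M f : test_in M f -> continuous f.
Proof. by move=> [/smooth_continuous]. Qed.

Lemma test_inD M f g : test_in M f -> test_in M g -> test_in M (f + g).
Proof.
move=> [sf fM] [sg gM]; split; first exact: smoothD.
by move=> x Mx; rewrite /= fctE fM// gM// addr0.
Qed.

Lemma test_inMl M f g : smooth f -> test_in M g -> test_in M (f * g).
Proof.
move=> sf [sg gM]; split; first exact: smoothM.
by move=> x Mx; rewrite /= fctE gM// mulr0.
Qed.

Lemma test_inMr M f g : test_in M f -> smooth g -> test_in M (f * g).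
Proof. by move=> tf sg; rewrite mulrC; exact: test_inMl. Qed.

Lemma test_inZ M (c : R) f : test_in M f -> test_in M (c *: f).
Proof. exact: test_inMl (smooth_cst c). Qed.

Lemma test_in0 M : test_in M (0 : 'cV[R]_n -> R).
Proof. by split=> //; exact: smooth_cst. Qed.

Lemma test_in_sum M (I : Type) (r : seq I) (P : pred I) (F : I -> 'cV[R]_n -> R) :
  (forall i, P i -> test_in M (F i)) -> test_in M (\sum_(i <- r | P i) F i).
Proof. by move=> tF; apply: (big_ind (test_in M)) => //; [exact: test_in0|exact: test_inD]. Qed.

Lemma test_in_derive M u f : test_in M f -> test_in M ('D_u f).
Proof. by move=> [sf fM]; split; [exact: smooth_derive|exact: supp_in_derive]. Qed.

Lemma test_functionP f :
  test_function R n f <-> exists2 M, 0 < M & test_in M f.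
Proof.
split=> [[sf /compact_bounded[M [_ HM]]]|[M M0 [sf fM]]].
  (* [compact_bounded] bounds the support by every number above [M], hence [M + 1]; the maximum with
     1 makes the radius positive. *)
  exists (Num.max 1 (M + 1)); first by rewrite lt_max ltr01.
  split => // x; rewrite gt_max => /andP[_ Mx]; apply/eqP; apply: contraTT Mx => fx.
  rewrite -leNgt; apply: HM; first by rewrite ltrDl.
  exact: subset_closure.
split => //; apply: subclosed_compact (@closed_closure _ _) (@norm_le_compact M) _.
have cl : closed [set x : 'cV[R]_n | `|x| <= M].
  by apply: compact_closed (@norm_le_compact M); exact: norm_hausdorff.
rewrite [X in _ `<=` X](_ : _ = closure [set x : 'cV[R]_n | `|x| <= M]); last first.
  by rewrite -closure_id.
apply: closure_subset => x /= fx; rewrite leNgt; apply: contra fx.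
by move=> /fM ->.
Qed.

End Smooth.

(** * Bump functions *)

Section Bump.
Context {R : realType}.

(** Restriction to the line h -> h u + x reduces this to the chain rule in one variable, so [f] has
    to be derivable along [u] only. *)
Lemma is_derive_comp (V : normedModType R) (phi : R -> R) (f : V -> R) x u (dphi df : R) :
  is_derive (f x) 1 phi dphi -> is_derive x u f df ->
  is_derive x u (phi \o f) (dphi * df).
Proof.
move=> [dp <-] [fx <-].
have Q (g : V -> R) : (fun h : R => h^-1 *: (((fun h : R => g (h *: u + x)) \o shift 0)
    (h *: 1) - g (0 *: u + x))) = (fun h : R => h^-1 *: ((g \o shift x) (h *: u) - g x)).
  by apply/funext => h /=; rewrite addr0 scale0r add0r [h%:A]mulr1.
have D (g : V -> R) : 'D_1 (fun h : R => g (h *: u + x)) 0 = 'D_u g x.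
  by rewrite /derive Q.
have fl : derivable (fun h : R => f (h *: u + x)) 0 1 by rewrite /derivable Q.
have fx0 : f (0 *: u + x) = f x by rewrite scale0r add0r.
have pl : derivable phi (f (0 *: u + x)) 1.
  by rewrite fx0; exact: dp.
have pfl : derivable (fun h : R => (phi \o f) (h *: u + x)) 0 1.
  apply/derivable1_diffP; apply: (@differentiable_comp _ _ _ _ (fun h : R => f (h *: u + x)) phi).
    exact: (derivable1_diffP _ _).1 fl.
  exact: (derivable1_diffP _ _).1 pl.
split; first exact/derivable1P.
have := derive1_comp fl pl; rewrite !derive1E D fx0 => <-.
by rewrite -(D (phi \o f)).
Qed.

(* A family stable under derivation up to linear combinations. *)
Definition flat (k : nat) (t : R) : R :=
  if 0 < t then t^-1 ^+ k * expR (- t^-1) else 0.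

Lemma flat_ge0 k t : 0 <= flat k t.
Proof.
by rewrite /flat; case: ifP => // /ltW t0; rewrite mulr_ge0 ?exprn_ge0 ?invr_ge0 ?expR_ge0.
Qed.

(** With y = 1/t, one term of the exponential series gives y^(k+2) / (k+2)! <= e^y. A quadratic
    bound is what makes the difference quotient at 0 tend to 0. *)
Lemma flat_le_sqr k : exists C : R, forall t, flat k t <= C * t ^+ 2.
Proof.
exists (k.+2`!%:R) => t; rewrite /flat; case: ifPn => t0; last first.
  by rewrite mulr_ge0 ?sqr_ge0 ?ler0n.
have y0 : 0 <= t^-1 by rewrite invr_ge0 ltW.
have F0 : 0 < k.+2`!%:R :> R by rewrite ltr0n fact_gt0.
have H0 : t^-1 ^+ k.+2 / k.+2`!%:R <= 1 + t^-1 ^+ k.+2 / k.+2`!%:R by rewrite lerDr.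
have := le_trans H0 (expR_ge1Dxn k.+1 y0); rewrite ler_pdivrMr// mulrC => H.
rewrite expRN ler_pdivrMr ?expR_gt0// mulrAC -ler_pdivrMr ?exprn_gt0//.
by rewrite -exprVn -exprD addn2.
Qed.

(** For t > 0 and y = 1/t, the derivative of y^k e^(-y) in y is multiplied by dy/dt = - y^2. At 0
    the quotient is at most C |h|. *)
Lemma is_derive_flat k (t : R) :
  is_derive t 1 (flat k) (flat k.+2 t - k%:R * flat k.+1 t).
Proof.
have [t0|t0|->] := ltgtP t 0.
- rewrite /flat !ltNge (ltW t0)/= mulr0 subr0.
  apply: (near_eq_is_derive _ (is_derive_cst (0 : R) t 1)).
  by near=> s; rewrite /= ltNge ltW//; near: s; exact: lt_nbhsl.
- pose phi (s : R) := s ^+ k * expR (- s).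
  have dphi (s : R) : is_derive s 1 phi (s ^+ k * - expR (- s) + k%:R * s ^+ k.-1 * expR (- s)).
    have d1 : is_derive s 1 (fun s : R => expR (- s)) (expR (- s) * -1).
      by apply: (@is_derive_comp _ expR -%R).
    have d2 : is_derive s 1 (fun s : R => s ^+ k) (k%:R * s ^+ k.-1).
      by split; [exact: exprn_derivable|rewrite exp_derive [_ *: 1]mulr1].
    apply: (is_derive_eq (is_deriveM d2 d1)).
    by rewrite /GRing.scale /=; ring.
  have dinv : is_derive t 1 (fun s : R => s^-1) (- t ^- 2).
    have t0' : t != 0 by rewrite gt_eqF.
    split; first exact: (@derivableV _ _ id).
    by rewrite (@deriveV _ _ id)// derive_id [_ *: _]mulr1.
  have dpt := @is_derive_comp _ phi _ t 1 _ _ (dphi _) dinv.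
  rewrite /flat t0; apply: (near_eq_is_derive _ (is_derive_eq dpt _)).
    by near=> s; rewrite /= ifT//; near: s; exact: lt_nbhsr.
  have -> : t ^- 2 = t^-1 ^+ 2 by rewrite exprVn.
  by case: (k) => [|j] /=; rewrite ?exprS; ring.
rewrite {2 3}/flat ltxx mulr0 subr0.
have [C HC] := flat_le_sqr k.
have C0 : 0 <= C by have := le_trans (flat_ge0 k 1) (HC 1); rewrite expr1n mulr1.
have L : h^-1 *: ((flat k \o shift 0) (h *: 1) - flat k 0) @[h --> (0 : R)^'] --> 0.
  have E h : (flat k \o shift 0) (h *: 1) - flat k 0 = flat k h.
    by rewrite /= addr0 [h%:A]mulr1 {2}/flat ltxx subr0.
  have C1 : 0 < C + 1 by rewrite ltr_wpDl.
  apply/cvgr0Pnorm_le => e e0; near=> h.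
  have h0 : h != 0 by near: h; exact: nbhs_dnbhs_neq.
  rewrite E normrZ normfV ler_pdivrMl ?normr_gt0// ger0_norm ?flat_ge0//.
  have he : `|h| <= e / (C + 1) by near: h; apply: dnbhs0_le; rewrite divr_gt0.
  apply: (le_trans (HC h)); rewrite -[h ^+ 2]real_normK ?num_real// expr2 mulrCA ler_wpM2l//.
  apply: (@le_trans _ _ ((C + 1) * `|h|)); first by rewrite mulrDl mul1r lerDl.
  by rewrite mulrC -ler_pdivlMr.
by split; [apply/cvg_ex; eexists; exact: L|exact: cvg_lim L].
Unshelve. all: by end_near. Qed.

Lemma continuous_flat k : continuous (flat k).
Proof.
move=> t; apply: differentiable_continuous; apply/derivable1_diffP.
exact: (@ex_derive _ _ _ _ _ _ _ (is_derive_flat k t)).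
Qed.

Lemma flat0_ge (t : R) : 1 <= t -> expR (-1) <= flat 0 t.
Proof.
move=> t1; have t0 : 0 < t by exact: lt_le_trans t1.
by rewrite /flat t0 expr0 mul1r ler_expR lerN2 invf_le1.
Qed.

Lemma flat_le0 k (t : R) : t <= 0 -> flat k t = 0.
Proof. by rewrite /flat ltNge => ->. Qed.

Context {n : nat}.

Lemma smooth_flat k (c s : R) (i : 'I_n) :
  smooth (fun x : 'cV[R]_n => flat k (c + s * x i ord0)).
Proof.
have ca : continuous (fun x : 'cV[R]_n => c + s * x i ord0).
  exact: (smooth_continuous (smoothD (smooth_cst c) (smoothZ s (smooth_coord i)))).
have cF k' : continuous (fun x : 'cV[R]_n => flat k' (c + s * x i ord0)).
  by move=> x; exact: (continuous_comp (ca x) (@continuous_flat k' _)).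
apply/smoothP => m; elim: m k => [|m IH] k; first by split=> //; exact: cF.
split=> [|j]; first exact: cF.
have D x : is_derive x (delta_mx j ord0) (fun x : 'cV[R]_n => flat k (c + s * x i ord0))
    ((flat k.+2 (c + s * x i ord0) - k%:R * flat k.+1 (c + s * x i ord0))
     * (s * (j == i)%:R)).
  apply: (@is_derive_comp _ (flat k) (fun x : 'cV[R]_n => c + s * x i ord0)).
    exact: is_derive_flat.
  have dc := is_derive_coord (delta_mx j ord0) x i.
  have := is_deriveD (is_derive_cst c x (delta_mx j ord0)) (is_deriveZ s dc).
  by rewrite mxE eqxx andbT add0r eq_sym.
split=> [x|]; first exact: (@ex_derive _ _ _ _ _ _ _ (D x)).
have -> : partial j (fun x : 'cV[R]_n => flat k (c + s * x i ord0)) =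
    cst (s * (j == i)%:R) * ((fun x : 'cV[R]_n => flat k.+2 (c + s * x i ord0)) +
      cst (- k%:R) * (fun x : 'cV[R]_n => flat k.+1 (c + s * x i ord0))).
  apply/funext => x; rewrite /partial (@derive_val _ _ _ _ _ _ _ (D x)).
  by rewrite !fctE mulrC mulNr.
apply: CkM; first exact: Ck_cst.
by apply: CkD; [exact: IH|apply: CkM; [exact: Ck_cst|exact: IH]].
Qed.

(** A product over the coordinates: one of its factors vanishes as soon as some |x_i| exceeds M + 1,
    and for |x_i| <= M both arguments of [flat 0] are at least 1. *)
Lemma bump_exists (M C : R) : 0 <= M -> 0 <= C ->
  exists phi : 'cV[R]_n -> R, [/\ test_function R n phi, forall x, 0 <= phi x &
    forall x, `|x| <= M -> C <= phi x].
Proof.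
move=> M0 C0.
pose b i := (fun x : 'cV[R]_n => flat 0 (M + 1 + 1 * x i ord0)) *
  (fun x : 'cV[R]_n => flat 0 (M + 1 + -1 * x i ord0)).
pose e := expR (-1) : R.
(* Each [b i] is at least [e ^+ 2] where [|x| <= M]; [A] compensates the product of these [n]
   bounds. *)
pose A := C * (e^-1 ^+ 2) ^+ n.
pose phi := cst A * \prod_(i < n) b i.
have phiE x : phi x = A * \prod_(i < n) b i x by rewrite /phi fctE fct_prodE.
have e0 : 0 < e by exact: expR_gt0.
have A0 : 0 <= A by rewrite mulr_ge0// exprn_ge0// exprn_ge0// invr_ge0 ltW.
have b0 i x : 0 <= b i x by rewrite /b fctE mulr_ge0// flat_ge0.
exists phi; split.
- apply/test_functionP; exists (M + 1); first by rewrite ltr_wpDl.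
  split.
    apply: smoothM; first exact: smooth_cst.
    by apply: smooth_prod => i _; apply: smoothM; exact: smooth_flat.
  move=> x Mx; rewrite phiE.
  have [i Mi] : exists i, M + 1 < `|x i ord0|.
    apply: contrapT => /forallNP H; move: Mx; rewrite ltNge => /negP; apply.
    apply/norm_leP; first by rewrite addr_ge0.
    by move=> i; rewrite leNgt; apply/negP; exact: H.
  rewrite (bigD1 i)//= (_ : b i x = 0) ?mul0r ?mulr0// /b fctE.
  move: Mi; rewrite ltr_normr => /orP[Mi|Mi].
    by rewrite [X in _ * X]flat_le0 ?mulr0// mulN1r subr_le0 ltW.
  by rewrite flat_le0 ?mul0r// mul1r -[x i ord0]opprK subr_le0 ltW.
- by move=> x; rewrite phiE mulr_ge0// prodr_ge0.
move=> x xM; rewrite phiE.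
have be i : e ^+ 2 <= b i x.
  rewrite /b fctE expr2; have := le_trans (coord_le_norm x i) xM.
  rewrite ler_norml => /andP[h1 h2].
  by apply: ler_pM; rewrite ?(ltW e0)//; apply: flat0_ge; lra.
have : (e ^+ 2) ^+ n <= \prod_(i < n) b i x.
  rewrite -[X in _ ^+ X]card_ord -prodr_const; apply: ler_prod => i _.
  by rewrite exprn_ge0 ?(ltW e0)//=; exact: be.
move=> /(ler_wpM2l A0); apply: le_trans.
rewrite /A -mulrA -exprMn -exprMn mulVf ?gt_eqF// expr1n expr1n mulr1.
by [].
Qed.

End Bump.

(** * Beam transforms against directional derivatives *)

Section Beams.
Context {R : realType} {n : nat}.
Implicit Types (f g h : 'cV[R]_n -> R) (x u v : 'cV[R]_n) (s : seq 'cV[R]_n).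

(** The fundamental theorem of calculus on a segment [a, 0]. For t <= a one has |x + t u| >= |t| |u|
    - |x| >= M + 1, so both the rest of the half-line and the boundary term at [a] contribute
    nothing. *)
Lemma beam_derive M g u : 0 < M -> test_in M g -> u != 0 ->
  beam u ('D_u g) = g.
Proof.
move=> M0 tg u0; have [sg gM] := tg; apply/funext => x.
have nu : 0 < `|u| by rewrite normr_gt0.
pose a := - ((`|x| + M + 1) / `|u|).
have a0 : a < 0 by rewrite oppr_lt0 divr_gt0// addr_gt0// ltr_wpDl.
have far (t : R) : t <= a -> M < `|x + t *: u|.
  move=> ta; have t0 : t < 0 by exact: le_lt_trans a0.
  have : `|t *: u| - `|x| <= `|x + t *: u|.
    by rewrite lerBlDl -{1}[t *: u](addKr x) (le_trans (ler_normD _ _))// normrN.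
  apply: lt_le_trans; rewrite normrZ ltr0_norm// ltrBrDl.
  move: ta; rewrite /a lerNr ler_pdivrMr// => /(lt_le_trans _); apply.
  by rewrite -addrA ltrD2l ltrDl.
pose F (t : R) := 'D_u g (x + t *: u).
have F0 (t : R) : t <= a -> F t = 0 by move=> /far; exact: supp_in_derive.
have dG (t : R) : is_derive t 1 (fun s : R => g (x + s *: u)) (F t).
  exact: is_derive_line (derivable_smooth sg).
have cline (f : 'cV[R]_n -> R) : continuous f -> continuous (fun s : R => f (x + s *: u)).
  move=> cf t.
  have cl : {for t, continuous (fun s : R => x + s *: u)}.
    apply: (@continuousD _ _ _ (cst x) (fun s : R => s *: u)); first exact: cst_continuous.
    exact: scalel_continuous.
  exact: (continuous_comp cl (cf (x + t *: u))).
have cF : continuous F := cline _ (smooth_continuous (smooth_derive u sg)).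
have cG := cline _ (smooth_continuous sg).
have -> : beam u ('D_u g) x = \int[lebesgue_measure]_(t in `[a, 0]) F t.
  rewrite /beam -/F Rintegral_mkcond [RHS]Rintegral_mkcond; congr Rintegral.
  apply/funext => t; rewrite !patchE !mem_setE !in_itv /=.
  have [at0|ta] := leP a t; rewrite //=.
  by case: ifP => // _; exact: F0 (ltW ta).
rewrite /Rintegral (@continuous_FTC2 _ F (fun s : R => g (x + s *: u)) a 0)//.
- by rewrite /= scale0r addr0 (gM (x + a *: u)) ?subr0//; exact: far.
- exact: continuous_subspaceT.
- split.
  + by move=> t _; exact: (@ex_derive _ _ _ _ _ _ _ (dG t)).
  + by apply: cvg_within_filter; exact: cG.
  + by apply: cvg_within_filter; exact: cG.
- by move=> t _; rewrite derive1E (@derive_val _ _ _ _ _ _ _ (dG t)).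
Qed.

Definition iter_derive s f : 'cV[R]_n -> R := foldr (fun u f => 'D_u f) f s.

Lemma smooth_iter_derive s f : smooth f -> smooth (iter_derive s f).
Proof. by move=> sf; elim: s => [|u s IH]; [exact: sf|exact: smooth_derive IH]. Qed.

Lemma test_in_iter_derive M s f : test_in M f -> test_in M (iter_derive s f).
Proof. by move=> tf; elim: s => [|u s IH]; [exact: tf|exact: test_in_derive IH]. Qed.

Lemma iter_derive_cat s s' f : iter_derive (s ++ s') f = iter_derive s (iter_derive s' f).
Proof. exact: foldr_cat. Qed.

Lemma iter_deriveC s u f : smooth f ->
  iter_derive s ('D_u f) = 'D_u (iter_derive s f).
Proof.
move=> sf; elim: s => [|v s IH]; first by [].
by rewrite /= IH; exact: derive_smoothC (smooth_iter_derive s sf).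
Qed.

Lemma iter_derive_perm s s' f : smooth f -> perm_eq s s' ->
  iter_derive s f = iter_derive s' f.
Proof.
move=> sf; elim: s s' => [|u s IH] s'; first by move/perm_size/esym/size0nil => ->.
move=> ss'; have us' : u \in s' by rewrite -(perm_mem ss') mem_head.
case/splitPr: us' ss' => s1 s2; rewrite perm_sym -(cat1s u s2) perm_catCA /= perm_cons perm_sym.
move=> /IH /= ->; rewrite !iter_derive_cat /=.
by rewrite (iter_deriveC s1 u (smooth_iter_derive s2 sf)).
Qed.

(** Beams and derivations come in the same order, not in inverse orders. Moving ['D_u] innermost
    lets the beams along [s] undo the derivations along [s] and leaves ['D_u g] to the outermost
    beam. *)
Lemma iter_beam_derive M s g : 0 < M -> test_in M g -> all (fun u => u != 0) s ->
  iter_beam s (iter_derive s g) = g.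
Proof.
move=> M0; elim: s g => //= u s IH g tg /andP[u0 s0].
rewrite -(iter_deriveC s u tg.1) (IH _ (test_in_derive u tg) s0).
exact: beam_derive tg u0.
Qed.

Lemma iter_beamD s f g : iter_beam_converges s f -> iter_beam_converges s g ->
  iter_beam s (f + g) = iter_beam s f + iter_beam s g.
Proof.
elim: s => //= u s IH [sf uf] [sg ug]; rewrite IH//; apply/funext => x.
by rewrite /beam fctE RintegralD//; [exact: uf|exact: ug].
Qed.

Lemma iter_beamZ s (c : R) f : iter_beam_converges s f ->
  iter_beam s (c *: f) = c *: iter_beam s f.
Proof.
elim: s => //= u s IH [sf uf]; rewrite IH//; apply/funext => x.
rewrite -[RHS]/(c * \int[lebesgue_measure]_(t in `]-oo, 0%R]) iter_beam s f (x + t *: u)).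
by rewrite -RintegralZl//; exact: uf.
Qed.

Lemma iter_beam_shift s f v : iter_beam s (f \o shift v) = iter_beam s f \o shift v.
Proof.
elim: s => //= u s ->; apply/funext => x; rewrite /beam /=; apply: eq_Rintegral => t _.
by rewrite addrAC.
Qed.

Lemma iter_beam0 s : iter_beam s (0 : 'cV[R]_n -> R) = 0.
Proof.
elim: s => //= u s ->; apply/funext => x; rewrite /beam.
by rewrite (_ : (fun _ => _) = cst 0)// Rintegral_cst//= mul0r.
Qed.

(** Domination has to be carried through the integrations together with convergence: at each level
    the dominating function is the partial iterated beam of [phi], integrable by the convergence
    hypothesis on [phi]. *)
Lemma iter_beam_dominated s (g_ : nat -> 'cV[R]_n -> R) g phi :
  (forall k, iter_beam_converges s (g_ k)) -> iter_beam_converges s g ->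
  iter_beam_converges s phi -> (forall k x, `|g_ k x| <= phi x) ->
  (forall x, g_ k x @[k --> \oo] --> g x) ->
  (forall k x, `|iter_beam s (g_ k) x| <= iter_beam s phi x) /\
  (forall x, iter_beam s (g_ k) x @[k --> \oo] --> iter_beam s g x).
Proof.
elim: s => //= u s IH Hg_ Hg Hphi gphi gg.
have [dom lim] := IH (fun k => (Hg_ k).1) Hg.1 Hphi.1 gphi gg.
split=> [k x|x].
  apply: (le_trans (le_normr_Rintegral _ _ )) => //; first exact: (Hg_ k).2.
  apply: le_Rintegral => //; last exact: Hphi.2.
  exact: integrable_abse ((Hg_ k).2 x).
have mI : measurable (`]-oo, 0%R]%classic : set R) by exact: measurable_itv.
have ae1 : {ae @lebesgue_measure R, forall t, `]-oo, 0%R]%classic t ->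
    (iter_beam s (g_ k) (x + t *: u))%:E @[k --> \oo] --> (iter_beam s g (x + t *: u))%:E}.
  by apply: aeW => t _; apply: cvg_EFin; [exact: nearW|exact: lim].
have ae2 : {ae @lebesgue_measure R, forall t (k : nat), `]-oo, 0%R]%classic t ->
    (`|(iter_beam s (g_ k) (x + t *: u))%:E| <= (iter_beam s phi (x + t *: u))%:E)%E}.
  by apply: aeW => t k _; rewrite lee_fin; exact: dom.
have mg_ k := measurable_int (@lebesgue_measure R) ((Hg_ k).2 x).
have mg := measurable_int (@lebesgue_measure R) (Hg.2 x).
have [_ _ D] := @dominated_convergence _ _ R (@lebesgue_measure R) _ mI _ _ _
  mg_ mg ae1 (Hphi.2 x) ae2.
apply: fine_cvg; rewrite fineK; first exact: D.
exact: integrable_fin_num (Hg.2 x).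
Qed.

Lemma smooth_shift f v : smooth f -> smooth (f \o shift v).
Proof.
have dE i (g : 'cV[R]_n -> R) x : (fun h : R => h^-1 *: (((g \o shift v) \o shift x)
    (h *: (delta_mx i ord0)) - (g \o shift v) x)) =
    (fun h : R => h^-1 *: ((g \o shift (x + v)) (h *: (delta_mx i ord0)) - g (x + v))).
  by apply/funext => h /=; rewrite addrA.
have cs (g : 'cV[R]_n -> R) : continuous g -> continuous (g \o shift v).
  move=> cg x; have cx : {for x, continuous (fun y : 'cV[R]_n => y + v)}.
    by apply: continuousD; [exact: cvg_id|exact: cst_continuous].
  exact: (continuous_comp cx (cg (x + v))).
move=> /smoothP sf; apply/smoothP => k.
elim: k f sf => [|k IH] f sf; (split; first exact: cs (sf 0%N).1) => // i.
have [_ /(_ i)[df _]] := sf 1%N; split=> [x|].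
  by rewrite /derivable dE; exact: df.
have -> : partial i (f \o shift v) = partial i f \o shift v.
  by apply/funext => x; rewrite /partial /derive dE.
apply: IH => k'; exact: ((sf k'.+1).2 i).2.
Qed.

Lemma test_in_shift M f v : test_in M f -> test_in (M + `|v|) (f \o shift v).
Proof.
move=> [sf fM]; split; first exact: smooth_shift.
move=> x Mx; apply: fM; have := ler_normB (x + v) v; rewrite addrK => H.
by rewrite -(ltrD2r `|v|); exact: lt_le_trans H.
Qed.

Lemma test_in_le (M M' : R) f : M <= M' -> test_in M f -> test_in M' f.
Proof. by move=> MM' [sf fM]; split; [exact: sf|exact: supp_in_le fM]. Qed.

Lemma test_functionZ (c : R) f : test_function R n f -> test_function R n (c *: f).
Proof.
by move=> /test_functionP[M M0 tf]; apply/test_functionP; exists M => //; exact: test_inZ.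
Qed.

Lemma test_functionD f g : test_function R n f -> test_function R n g ->
  test_function R n (f + g).
Proof.
move=> /test_functionP[M M0 tf] /test_functionP[N N0 tg]; apply/test_functionP.
exists (Num.max M N); first by rewrite lt_max M0.
apply: test_inD; [apply: test_in_le tf|apply: test_in_le tg]; rewrite le_max lexx ?orbT//.
Qed.

Lemma test_function_shift f v : test_function R n f -> test_function R n (f \o shift v).
Proof.
move=> /test_functionP[M M0 tf]; apply/test_functionP; exists (M + `|v|).
  by rewrite ltr_wpDr.
exact: test_in_shift.
Qed.

Lemma test_function_derive f u : test_function R n f -> test_function R n ('D_u f).
Proof.
move=> /test_functionP[M M0 tf]; apply/test_functionP; exists M; first exact: M0.
exact: test_in_derive.
Qed.

(** Written as a combination of [f] and a translate of it, so that linearity and translation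
    invariance of S apply as they stand. *)
Definition difference_quotient u f (k : nat) : 'cV[R]_n -> R :=
  k.+1%:R *: (f \o shift (k.+1%:R^-1 *: u) + (-1) *: f).

Lemma difference_quotientE u f k x :
  difference_quotient u f k x = k.+1%:R * (f (x + k.+1%:R^-1 *: u) - f x).
Proof. by rewrite /difference_quotient -[LHS]/(_ * (_ + -1 * _)) mulN1r. Qed.

(* Difference quotients of a test function converge to its derivative while
   staying below a single test function: this makes every realizable
   composition of beam transforms commute with derivations. *)
Lemma difference_quotient_dominated u f : test_function R n f ->
  (forall x, difference_quotient u f k x @[k --> \oo] --> 'D_u f x) /\
  exists2 phi, test_function R n phi &
    forall k x, `|difference_quotient u f k x| <= phi x.
Proof.
move=> /test_functionP[M M0 tf]; have [sf fM] := tf; set q := difference_quotient u f.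
split=> [x|].
  have D : h^-1 *: ((f \o shift x) (h *: u) - f x) @[h --> (0 : R)^'] --> 'D_u f x.
    exact: (derivable_smooth sf).
  have H : (k.+1%:R^-1 : R) @[k --> \oo] --> (0 : R)^'.
    move=> A nA.
    have H0 : \forall k \near \oo, (k.+1%:R^-1 != 0 :> R) -> A k.+1%:R^-1.
      exact: (cvg_harmonic nA).
    apply: (filterS _ H0) => k Hk; apply: Hk.
    by rewrite invr_eq0 pnatr_eq0.
  have := cvg_comp _ _ H D.
  rewrite (_ : _ \o _ = fun k => q k x) //; apply/funext => k /=.
  by rewrite invrK /q difference_quotientE [x + _]addrC.
have [C C0 HC] := supp_in_bounded (supp_in_derive u fM)
  (smooth_continuous (smooth_derive u sf)).
(* By the mean value theorem a difference quotient at [x] is the value of ['D_u f] at a point within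
   [|u|] of [x], hence the height [C] and the radius [M + |u|]. *)
have [phi [tphi phi0 Cphi]] := @bump_exists R n (M + `|u|) C (addr_ge0 (ltW M0) (normr_ge0 u)) C0.
exists phi; first exact: tphi.
move=> k x; have [c ck Ec] := line_mvt x k.+1%:R^-1 (fun y => @derivable_smooth R n f u y sf).
have -> : q k x = 'D_u f (x + c *: u).
  by rewrite /q difference_quotientE Ec mulrA mulfV ?mul1r//.
have c1 : `|c| <= 1.
  by apply: (le_trans ck); rewrite ger0_norm ?invr_ge0// invf_le1// ler1n.
have [xM|xM] := leP `|x| (M + `|u|); first by apply: (le_trans (HC _)); exact: Cphi.
rewrite (supp_in_derive u fM) ?normr0//.
have : `|x| <= `|x + c *: u| + `|c *: u| by rewrite -{1}[x](addrK (c *: u)) ler_normB.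
rewrite normrZ => /(lt_le_trans xM) H.
have : `|c| * `|u| <= `|u| by rewrite ler_piMl.
by move: H; lra.
Qed.

End Beams.

(** * The star transform on test functions *)

Section Star.
Context {R : realType} {m n : nat}.
Implicit Types (p : mpoly m R) (U : 'M[R]_(m, n)) (a b c : multinom m).
Implicit Types (f g h : 'cV[R]_n -> R) (x u v : 'cV[R]_n).

(** Equality holds up to permutation only, because the directions are grouped by index. *)
Lemma monomial_dirs_add U a b c : (forall j, a j = (b j + c j)%N) ->
  perm_eq (monomial_dirs U a) (monomial_dirs U b ++ monomial_dirs U c).
Proof.
move=> abc; rewrite /monomial_dirs; elim: (enum _) => //= j r IH.
rewrite abc nseqD -!catA perm_cat2l perm_sym perm_catCA perm_cat2l perm_sym.
exact: IH.
Qed.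

Lemma monomial_dirs_neq0 U a : (forall j, row j U != 0) ->
  all (fun u => u != 0) (monomial_dirs U a).
Proof.
move=> U0; apply/allP => u /flattenP[s /mapP[j _ ->]] /nseqP[-> _].
by apply: contra (U0 j) => /eqP E; rewrite -[row j U]trmxK E trmx0.
Qed.

Lemma star0 p U : star p U 0 = 0.
Proof.
by apply/funext => x; rewrite /star big1// => a _; rewrite iter_beam0 mulr0.
Qed.

Lemma starD p U f g : realizable p U ->
  test_function R n f -> test_function R n g ->
  star p U (f + g) = star p U f + star p U g.
Proof.
move=> rp tf tg; apply/funext => x.
rewrite -[RHS]/(star p U f x + star p U g x) /star -big_split /=.
by apply: eq_big_seq => a pa; rewrite iter_beamD ?mulrDr//; exact: rp.
Qed.

Lemma starZ p U (c : R) f : realizable p U -> test_function R n f ->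
  star p U (c *: f) = c *: star p U f.
Proof.
move=> rp tf; apply/funext => x.
rewrite -[RHS]/(c * star p U f x) /star big_distrr /=.
by apply: eq_big_seq => a pa; rewrite iter_beamZ 1?mulrCA//; exact: rp.
Qed.

Lemma star_shift p U f v : star p U (f \o shift v) = star p U f \o shift v.
Proof.
by apply/funext => x; apply: eq_bigr => a _; rewrite iter_beam_shift.
Qed.

(** S kills every difference quotient of [f], and the limit is taken in each monomial separately.
    Stability of the kernel under derivation is all that is extracted from the commutation. *)
Lemma star_derive_eq0 p U u f : realizable p U -> test_function R n f ->
  star p U f = 0 -> star p U ('D_u f) = 0.
Proof.
move=> rp tf Sf0; have [lim [phi tphi dom]] := difference_quotient_dominated u tf.
have tq k : test_function R n (difference_quotient u f k).
  apply/test_functionZ/test_functionD; first exact: test_function_shift.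
  exact: test_functionZ.
have Sq k : star p U (difference_quotient u f k) = 0.
  have t1 := test_function_shift (k.+1%:R^-1 *: u) tf; have t2 := test_functionZ (-1) tf.
  rewrite /difference_quotient (starZ _ rp (test_functionD t1 t2)) (starD rp t1 t2).
  by rewrite (starZ _ rp tf) star_shift Sf0 scaler0 addr0; apply/funext => x; exact: mulr0.
have tD := test_function_derive u tf.
apply/funext => x.
have L : star p U (difference_quotient u f k) x @[k --> \oo] --> star p U ('D_u f) x.
  rewrite /star; elim: (msupp p) (fun a => rp _ tphi a) (fun k a => rp _ (tq k) a)
    (fun a => rp _ tD a) => [|a r IH] rphi rq rD.
    by rewrite big_nil; under eq_cvg do rewrite big_nil; exact: cvg_cst.
  rewrite big_cons; under eq_cvg do rewrite big_cons.
  apply: cvgD.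
    apply: cvgMl_tmp.
    apply: (iter_beam_dominated _ _ _ dom lim).2.
    - by move=> k; apply: rq; rewrite mem_head.
    - by apply: rD; rewrite mem_head.
    - by apply: rphi; rewrite mem_head.
  by apply: IH => [b br|k b br|b br]; [apply: rphi|apply: rq|apply: rD]; rewrite inE br orbT.
rewrite -(cvg_lim (@Rhausdorff R) L); under eq_fun do rewrite Sq.
exact: lim_cst.
Qed.

Lemma star_iter_derive_eq0 p U s f : realizable p U -> test_function R n f ->
  star p U f = 0 -> star p U (iter_derive s f) = 0.
Proof.
move=> rp /test_functionP[M M0 tf] Sf; elim: s => [|u s IH]; first exact: Sf.
apply: (star_derive_eq0 u rp _ IH); apply/test_functionP.
by exists M; [exact: M0|exact: test_in_iter_derive].
Qed.

Definition degrees p : multinom m := Multinom [tuple degree_in j p | j < m].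

Definition codegrees p a : multinom m :=
  Multinom [tuple (degree_in j p - a j)%N | j < m].

Lemma star_iter_derive M p U g : (forall j, row j U != 0) -> 0 < M -> test_in M g ->
  star p U (iter_derive (monomial_dirs U (degrees p)) g) =
  \sum_(a <- msupp p) mcoeff a p *: iter_derive (monomial_dirs U (codegrees p a)) g.
Proof.
move=> U0 M0 tg; apply/funext => x; rewrite /star fct_sumE.
apply: eq_big_seq => a pa; rewrite -[RHS]/(_ * _); congr (_ * _).
(* The truncated subtraction in [codegrees] is exact here, as [a j] is at most the degree in x_j for
   [a] in the support. *)
have E : perm_eq (monomial_dirs U (degrees p))
    (monomial_dirs U a ++ monomial_dirs U (codegrees p a)).
  by apply: monomial_dirs_add => j; rewrite !multinomE !tnth_mktuple subnKC ?leq_degree_in.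
rewrite (iter_derive_perm tg.1 E) iter_derive_cat.
rewrite (iter_beam_derive M0 (test_in_iter_derive _ tg))//.
exact: monomial_dirs_neq0.
Qed.

End Star.

(** * Means over grids of a cube *)

Section LatticeMean.
Context {R : realType} {n : nat} (L : R).
Hypothesis L0 : 0 < L.
Implicit Types (f g : 'cV[R]_n -> R) (x : 'cV[R]_n).

(** A half-open grid of [-L, L)^n with step 2L/N: the face at -L is included and the face at L is
    not, so the grid is a discrete torus. *)
Definition lattice_point N (z : {ffun 'I_n -> 'I_N}) : 'cV[R]_n :=
  \col_i (- L + 2 * L * (z i)%:R / N%:R).

Definition lattice_mean N f : R :=
  (N%:R ^+ n)^-1 * \sum_(z : {ffun 'I_n -> 'I_N}) f (lattice_point z).

(* Stands for the vanishing of the integral of [f] over [R^n]. *)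
Definition null_mean f : Prop := lattice_mean N.+1 f @[N --> \oo] --> (0 : R).

Lemma lattice_meanD N f g :
  lattice_mean N (f + g) = lattice_mean N f + lattice_mean N g.
Proof. by rewrite /lattice_mean -mulrDr -big_split. Qed.

Lemma lattice_meanZ N (c : R) f : lattice_mean N (c *: f) = c * lattice_mean N f.
Proof. by rewrite /lattice_mean mulrCA [in RHS]big_distrr. Qed.

Lemma null_meanD f g : null_mean f -> null_mean g -> null_mean (f + g).
Proof.
move=> nf ng; rewrite /null_mean.
have -> : (fun N => lattice_mean N.+1 (f + g)) =
    (fun N => lattice_mean N.+1 f + lattice_mean N.+1 g).
  by apply/funext => N; exact: lattice_meanD.
have := cvgD nf ng; rewrite addr0; exact.
Qed.

Lemma null_meanZ (c : R) f : null_mean f -> null_mean (c *: f).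
Proof.
move=> nf; rewrite /null_mean.
have -> : (fun N => lattice_mean N.+1 (c *: f)) = (fun N => c * lattice_mean N.+1 f).
  by apply/funext => N; exact: lattice_meanZ.
have := @cvgMl_tmp _ _ _ _ _ c _ nf; rewrite mulr0; exact.
Qed.

Lemma lattice_mean_le N f (C : R) : (0 < N)%N ->
  `|\sum_(z : {ffun 'I_n -> 'I_N}) f (lattice_point z)| <= (N%:R ^+ n) * C ->
  `|lattice_mean N f| <= C.
Proof.
move=> N0 H; have Nn : 0 < N%:R ^+ n :> R by rewrite exprn_gt0// ltr0n.
by rewrite /lattice_mean normrM normfV (gtr0_norm Nn) ler_pdivrMl.
Qed.

Definition shift_index N (i : 'I_n) (z : {ffun 'I_n -> 'I_N}) : {ffun 'I_n -> 'I_N} :=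
  [ffun j => if j == i then ordS (z j) else z j].

Lemma shift_index_bij N i : bijective (@shift_index N i).
Proof.
have [g gK Kg] := @ordS_bij N.
exists (fun z : {ffun 'I_n -> 'I_N} => [ffun j => if j == i then g (z j) else z j]) => z;
  by apply/ffunP => j; rewrite !ffunE; case: (j == i).
Qed.

(** When the shift wraps around, the two points have i-th coordinates L and -L; both lie outside the
    support, where [f] is 0. *)
Lemma lattice_shift N i f (M : R) (z : {ffun 'I_n -> 'I_N}) : M < L -> supp_in M f ->
  f (lattice_point z + (2 * L / N%:R) *: delta_mx i ord0) =
  f (lattice_point (shift_index i z)).
Proof.
move=> ML fM.
have N0 : (0 < N)%N by exact: leq_ltn_trans (leq0n _) (ltn_ord (z i)).
have N0' : N%:R != 0 :> R by rewrite pnatr_eq0 -lt0n.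
have far x : x i ord0 = L \/ x i ord0 = - L -> f x = 0.
  move=> xi; apply: fM; apply: (lt_le_trans _ (coord_le_norm x i)).
  by case: xi => ->; rewrite ?normrN gtr0_norm.
have [zi|zi] := ltnP (z i).+1 N; last first.
  have zN : (z i).+1 = N by apply/eqP; rewrite eqn_leq zi ltn_ord.
  rewrite far; last first.
    have zR : N%:R = (z i)%:R + 1 :> R by rewrite natr1 zN.
    by left; rewrite !mxE !eqxx mulr1; rewrite zR in N0' *; field.
  rewrite far//; right; rewrite mxE ffunE eqxx /= zN modnn mulr0 mul0r addr0//.
congr f; apply/matrixP => j k; rewrite (ord1 k) !mxE ffunE.
have [->|ji] := eqVneq j i; last by rewrite mulr0 addr0.
by rewrite eqxx /= modn_small// -[(z i).+1%:R]natr1; field.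
Qed.

(** Invariance under a shift by one grid step [e] makes the mean of (g(x + e e_i) - g(x)) / e
    exactly 0. Two applications of the mean value theorem bound the distance from this quotient to
    [partial i g] by [C * e], with [C] a bound on the second derivative. *)
Lemma null_mean_partial M i g : M < L -> test_in M g -> null_mean (partial i g).
Proof.
move=> ML tg; have [sg gM] := tg.
have s1 := smooth_partial i sg; have s2 := smooth_partial i s1.
have [C C0 HC] := supp_in_bounded (supp_in_derive (delta_mx i ord0)
  (supp_in_derive (delta_mx i ord0) gM)) (smooth_continuous s2).
have bound N : `|lattice_mean N.+1 (partial i g)| <= C * (2 * L / N.+1%:R).
  set e := 2 * L / N.+1%:R.
  have e0 : 0 < e by rewrite divr_gt0// mulr_gt0.
  apply: lattice_mean_le => //.
  have S0 : \sum_(z : {ffun 'I_n -> 'I_N.+1}) e^-1 *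
      (g (lattice_point z + e *: delta_mx i ord0) - g (lattice_point z)) = 0.
    rewrite -big_distrr /= sumrB [X in X - _](_ : _ =
      \sum_(z : {ffun 'I_n -> 'I_N.+1}) g (lattice_point z)) ?subrr ?mulr0//.
    rewrite [RHS](reindex (@shift_index _ i)) /=; last exact/onW_bij/shift_index_bij.
    by apply: eq_bigr => z _; exact: lattice_shift ML gM.
  have -> : \sum_(z : {ffun 'I_n -> 'I_N.+1}) partial i g (lattice_point z) =
      \sum_(z : {ffun 'I_n -> 'I_N.+1}) (partial i g (lattice_point z) -
      e^-1 * (g (lattice_point z + e *: delta_mx i ord0) - g (lattice_point z))).
    by rewrite sumrB S0 subr0.
  apply: (le_trans (ler_norm_sum _ _ _)).
  have -> : N.+1%:R ^+ n * (C * e) = \sum_(z : {ffun 'I_n -> 'I_N.+1}) C * e.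
    by rewrite sumr_const card_ffun !card_ord -natrX mulr_natl.
  apply: ler_sum => z _.
  have [c ce Ec] := line_mvt (lattice_point z) e
    (fun y => @smooth_derivable _ _ g i y sg).
  have [d _ Ed] := line_mvt (lattice_point z) c
    (fun y => @smooth_derivable _ _ _ i y s1).
  rewrite Ec mulKf ?gt_eqF// -normrN opprB.
  rewrite -[X in `|X|]/(partial i g (lattice_point z + c *: delta_mx i ord0) -
    partial i g (lattice_point z)) Ed normrM (mulrC C).
  by apply: ler_pM => //; rewrite (gtr0_norm e0) in ce.
have B0 : C * (2 * L / N.+1%:R) @[N --> \oo] --> (0 : R).
  have -> : (fun N => C * (2 * L / N.+1%:R)) = (fun N => C * (2 * L) * harmonic N).
    by apply/funext => N; rewrite mulrA.
  have := @cvgMl_tmp _ _ _ _ _ (C * (2 * L)) _ (@cvg_harmonic R); rewrite mulr0; exact.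
move/cvgr0Pnorm_le: B0 => B0; apply/cvgr0Pnorm_le => e e0; near=> N.
by apply: (le_trans (bound N)); apply: (le_trans (ler_norm _)); near: N; exact: B0.
Unshelve. all: by end_near. Qed.

(** If [f] exceeds [d] near [x0], it does so on a whole cell of some grid with [K] cells per side.
    In every refinement that cell holds the fraction K^(-n) of the points, which keeps the mean
    above K^(-n) d. *)
Lemma null_mean_eq0 M f : M < L -> continuous f -> supp_in M f ->
  (forall x, 0 <= f x) -> null_mean f -> f = 0.
Proof.
move=> ML cf fM f0 nf; apply/funext => x0 /=.
apply: contrapT => /eqP fx0; have {}fx0 : 0 < f x0 by rewrite lt_def fx0 f0.
have xM : `|x0| <= M by rewrite leNgt; apply/negP => /fM; move: fx0 => /[swap] ->; rewrite ltxx.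
pose d := f x0 / 2; have d0 : 0 < d by rewrite divr_gt0.
have [r r0 Hr] : exists2 r, 0 < r & forall y, `|x0 - y| < r -> d < f y.
  have : \forall y \near x0, d < f y.
    by apply: (cvgr_gt _ (cf x0)); rewrite /d ltr_pdivrMr// ltr_pMr// ltr1n.
  by move=> /nbhs_normP[r r0 Hr]; exists r.
have [K Kn Kr] : exists2 K : nat, (0 < K)%N & 2 * L / K%:R < r.
  exists (Num.truncn (2 * L / r)).+1 => //.
  by rewrite ltr_pdivrMr// (mulrC r) -ltr_pdivrMr//; exact: truncnS_gt.
have K0 : 0 < K%:R :> R by rewrite ltr0n.
(* Position of [x0] in units of the coarse cell; its integer part is the index of the cell
   containing [x0]. *)
pose X i := (x0 i ord0 + L) * K%:R / (2 * L).
have L2 : 0 < 2 * L by rewrite mulr_gt0.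
have xi i : - L < x0 i ord0 < L.
  by rewrite -ltr_norml (le_lt_trans (coord_le_norm x0 i))// (le_lt_trans xM).
have X0 i : 0 <= X i.
  have /andP[h _] := xi i; rewrite /X divr_ge0 ?(ltW L2)// mulr_ge0 ?(ltW K0)//; lra.
have XK i : (Num.truncn (X i) < K)%N.
  rewrite -(ltr_nat R); apply: (@le_lt_trans _ _ (X i)).
    by have /andP[] := truncn_itv (X0 i).
  rewrite /X ltr_pdivrMr// mulrC ltr_pM2l//; have /andP[_ h] := xi i; lra.
have [J JP] : exists J, `|lattice_mean (K * J.+1) f| < (K%:R ^+ n)^-1 * d.
  have e0 : 0 < (K%:R ^+ n)^-1 * d by rewrite mulr_gt0// invr_gt0 exprn_gt0.
  have /cvgr0Pnorm_lt /(_ _ e0) [N _ HN] := nf.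
  have H1 : (N <= (K * N.+1).-1)%N by rewrite -ltnS prednK ?muln_gt0 ?Kn// leq_pmull.
  by exists N; have := HN _ H1; rewrite /= prednK ?muln_gt0 ?Kn.
have ltKJ i (w : 'I_J.+1) : (Num.truncn (X i) * J.+1 + w < K * J.+1)%N.
  apply: (@leq_trans ((Num.truncn (X i)).+1 * J.+1)); last by rewrite leq_mul2r XK orbT.
  by rewrite mulSn addnC ltn_add2r.
(* The points of the fine grid lying in the coarse cell of [x0]; they are within 2L/K < r of
   [x0]. *)
pose emb (w : {ffun 'I_n -> 'I_J.+1}) : {ffun 'I_n -> 'I_(K * J.+1)} :=
  [ffun i => Ordinal (ltKJ i (w i))].
have emb_inj : injective emb.
  move=> w w' /ffunP E; apply/ffunP => i; apply/val_inj.
  by have := E i; rewrite !ffunE => /(congr1 val) /= /addnI.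
have demb w : d <= f (lattice_point (emb w)).
  apply/ltW/Hr; apply: le_lt_trans Kr; apply/norm_leP; first by rewrite divr_ge0// ltW.
  move=> i; rewrite !mxE ffunE /=.
  set k := Num.truncn (X i).
  have J0 : (0 : R) < J.+1%:R by rewrite ltr0n.
  have E : x0 i ord0 - (- L + 2 * L * (k * J.+1 + w i)%:R / (K * J.+1)%:R) =
      (2 * L / K%:R) * (X i - k%:R - (w i)%:R / J.+1%:R).
    rewrite /X natrD !natrM; field; rewrite ?gt_eqF//.
  rewrite E normrM (ger0_norm (x := 2 * L / K%:R)) ?divr_ge0 ?(ltW L2)//.
  rewrite ler_piMr ?divr_ge0 ?(ltW L2)//.
  have /andP[h1 h2] := truncn_itv (X0 i); rewrite -/k in h1 h2.
  have w0 : 0 <= (w i)%:R / J.+1%:R :> R by rewrite divr_ge0.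
  have w1 : (w i)%:R / J.+1%:R <= 1 :> R by rewrite ler_pdivrMr// mul1r ler_nat ltnW.
  move: h1 h2 w0 w1; rewrite -natr1 ler_norml.
  by move: (X i) (k%:R) (_ / _) => a b c *; apply/andP; split; lra.
have : (K%:R ^+ n)^-1 * d <= lattice_mean (K * J.+1) f.
  rewrite /lattice_mean natrM exprMn invfM -mulrA ler_pM2l ?invr_gt0 ?exprn_gt0//.
  rewrite ler_pdivlMl ?exprn_gt0//.
  pose T : {set {ffun 'I_n -> 'I_J.+1}} := [set: _]%SET.
  apply: (@le_trans _ _ (\sum_(z in (emb @: T)%SET) f (lattice_point z))); last first.
    by rewrite [leRHS](bigID (mem (emb @: T)%SET)) /= lerDl sumr_ge0.
  rewrite big_imset /=; last by move=> ? ? _ _; exact: emb_inj.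
  apply: (@le_trans _ _ (\sum_(w in T) d)); last by apply: ler_sum => w _; exact: demb.
  by rewrite sumr_const cardsT card_ffun !card_ord -natrX mulr_natl.
have := ler_norm (lattice_mean (K * J.+1) f); lra.
Qed.

End LatticeMean.

(** * Induction principles for polynomials *)

Section PolynomialInduction.
Context {R : realType} {n : nat}.
Implicit Types (q r : mpoly n R) (a : multinom n) (P : mpoly n R -> Prop).

Local Notation var i := (mpolyX R (mnm1 i) : mpoly n R).

Lemma mpoly_ind_monom P : (forall a, P (mpolyX R a)) ->
  (forall q r, P q -> P r -> P (q + r)) -> (forall (c : R) q, P q -> P (c *: q)) ->
  forall q, P q.
Proof.
move=> PX PD PZ q; rewrite [q]mpolyE.
apply: (big_ind P) => [|r s|a _]; [|exact: PD|exact: PZ].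
by rewrite -(scale0r (mpolyX R (mnm0 : multinom n))); exact: PZ.
Qed.

Lemma mpoly_ind_mul P : P 1 ->
  (forall q r, P q -> P r -> P (q + r)) -> (forall (c : R) q, P q -> P (c *: q)) ->
  (forall i q, P q -> P (var i * q)) -> forall q, P q.
Proof.
move=> P1 PD PZ PM; apply: mpoly_ind_monom => // a; rewrite mpolyXE_id.
elim: (index_enum _) => [|i r IH]; first by rewrite big_nil.
rewrite big_cons; elim: (a i) => [|k IHk]; first by rewrite expr0 mul1r.
by rewrite exprS -mulrA; exact: PM.
Qed.

Lemma mderiv_var i j : mderiv j (var i) = mpolyC n (i == j)%:R.
Proof.
rewrite mderivX mnm1E; case: eqVneq => [->|_]; last by rewrite scale0r mpolyC0.
rewrite scale1r mpolyC1 -mpolyX0; congr mpolyX.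
by apply/mnmP => k; rewrite mnmBE subnn mnm0E.
Qed.

Lemma msize_mderiv i q : q != 0 -> (msize (mderiv i q) < msize q)%N.
Proof.
move=> q0; have q0' : (0 < msize q)%N by rewrite lt0n msize_poly_eq0.
rewrite [msize (mderiv i q)]msizeE -(prednK q0') ltnS.
apply/bigmax_leqP_seq => a; rewrite mcoeff_msupp mcoeff_deriv => aq _.
have : (mdeg (mnm_add a (mnm1 i)) < msize q)%N.
  apply: msize_mdeg_lt; rewrite mcoeff_msupp; apply: contra aq => /eqP ->.
  by rewrite mul0rn.
by rewrite mdegD mdeg1 addn1 -{1}(prednK q0') ltnS.
Qed.

Lemma mderiv_eq0 q : (forall i, mderiv i q = 0) -> q = mpolyC n (mcoeff mnm0 q).
Proof.
move=> dq; apply/mpolyP => a; rewrite mcoeffC.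
have [->|a0] := eqVneq a mnm0; first by rewrite mulr1.
rewrite mulr0; have [i ai] : exists i, (0 < a i)%N.
  apply/existsP; apply: contraNT a0 => /existsPn ai.
  by apply/eqP/mnmP => i; rewrite mnm0E; apply/eqP; rewrite -leqn0 leqNgt ai.
have := mcoeff_deriv i (mnm_sub a (mnm1 i)) q; rewrite dq mcoeff0 submK.
  by move=> /esym/eqP; rewrite mulrn_eq0 /= => /eqP.
by apply/mnm_lepP => j; rewrite mnm1E; case: eqP => // <-.
Qed.

(** In characteristic zero a nonconstant polynomial has a nonzero partial derivative, of smaller
    size, so repeated derivation ends at a nonzero constant. *)
Lemma mpoly_ind_deriv P : (forall c : R, c != 0 -> P (mpolyC n c)) ->
  (forall i q, P (mderiv i q) -> P q) -> forall q, q != 0 -> P q.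
Proof.
move=> PC PD q; elim: {q}(msize q).+1 {-2}q (ltnSn (msize q)) => // k IH q qk q0.
have [dq|/existsNP[i /eqP dq]] := pselect (forall i, mderiv i q = 0).
  rewrite (mderiv_eq0 dq); apply: PC; apply: contra q0 => /eqP c0.
  by rewrite (mderiv_eq0 dq) c0 mpolyC0.
apply: (PD i); apply: IH => //; rewrite ltnS in qk.
exact: leq_trans (msize_mderiv i q0) qk.
Qed.

End PolynomialInduction.

(** * Constant coefficient differential operators *)

Section DiffOp.
Context {R : realType} {n : nat}.
Implicit Types (f g h : 'cV[R]_n -> R).

(** Cancellations make the three supports differ; all sums are extended to a common list, where the
    added coefficients are 0. *)
Lemma mpoly_sum_linear {m : nat} (V : lmodType R) (F : multinom m -> V) (c : R) (q r : mpoly m R) :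
  \sum_(a <- msupp (c *: q + r)) mcoeff a (c *: q + r) *: F a =
  c *: (\sum_(a <- msupp q) mcoeff a q *: F a) + \sum_(a <- msupp r) mcoeff a r *: F a.
Proof.
pose s := undup (msupp (c *: q + r) ++ msupp q ++ msupp r).
have W t : {subset msupp t <= s} ->
    \sum_(a <- msupp t) mcoeff a t *: F a = \sum_(a <- s) mcoeff a t *: F a.
  move=> ts; rewrite [RHS](bigID (mem (msupp t)) xpredT) /= [X in _ + X]big1 ?addr0; last first.
    by move=> a; rewrite -mcoeff_eq0 => /eqP ->; rewrite scale0r.
  rewrite -[RHS]big_filter; apply: perm_big; apply: uniq_perm.
  - exact: msupp_uniq.
  - by rewrite filter_uniq// undup_uniq.
  by move=> a; rewrite mem_filter /=; case: (boolP (a \in msupp t)) => // /ts ->.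
rewrite !W; try by move=> a at_; rewrite mem_undup !mem_cat at_ ?orbT.
rewrite scaler_sumr -big_split /=; apply: eq_bigr => a _.
by rewrite mcoeffD mcoeffZ scalerDl scalerA.
Qed.

Section Directions.
Context {m : nat} (U : 'M[R]_(m, n)).
Implicit Types (q r : mpoly m R) (a : multinom m).

Definition diff_op q f : 'cV[R]_n -> R :=
  \sum_(a <- msupp q) mcoeff a q *: iter_derive (monomial_dirs U a) f.

Lemma diff_op_linear (c : R) q r f :
  diff_op (c *: q + r) f = c *: diff_op q f + diff_op r f.
Proof. exact: mpoly_sum_linear. Qed.

Lemma diff_opD q r f : diff_op (q + r) f = diff_op q f + diff_op r f.
Proof. by rewrite -[q in LHS]scale1r diff_op_linear scale1r. Qed.

Lemma diff_op0 f : diff_op 0 f = 0.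
Proof. by rewrite /diff_op msupp0 big_nil. Qed.

Lemma diff_opZ (c : R) q f : diff_op (c *: q) f = c *: diff_op q f.
Proof. by rewrite -[_ *: q]addr0 diff_op_linear diff_op0 addr0. Qed.

Lemma diff_op_sum (I : Type) (s : seq I) (P : pred I) (F : I -> mpoly m R) f :
  diff_op (\sum_(i <- s | P i) F i) f = \sum_(i <- s | P i) diff_op (F i) f.
Proof.
by apply: (big_morph (fun q => diff_op q f)) => [q r|]; [exact: diff_opD|exact: diff_op0].
Qed.

Lemma diff_opX a f : diff_op (mpolyX R a) f = iter_derive (monomial_dirs U a) f.
Proof. by rewrite /diff_op msuppX big_seq1 mcoeffX eqxx scale1r. Qed.

Lemma diff_op_0r q : diff_op q 0 = 0.
Proof.
rewrite /diff_op big1// => a _; rewrite (_ : iter_derive _ 0 = 0) ?scaler0//.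
elim: (monomial_dirs U a) => //= u s ->; apply/funext => x; exact: derive_cst.
Qed.

Lemma diff_op1 f : diff_op 1 f = f.
Proof.
rewrite -mpolyX0 diff_opX; rewrite (_ : monomial_dirs U mnm0 = [::])//.
rewrite /monomial_dirs; elim: (enum _) => //= j r ->; by rewrite mnm0E.
Qed.

Lemma diff_opC (c : R) f : diff_op (mpolyC m c) f = c *: f.
Proof. by rewrite -[mpolyC m c]mulr1 mul_mpolyC diff_opZ diff_op1. Qed.

Lemma smooth_diff_op q f : smooth f -> smooth (diff_op q f).
Proof.
by move=> sf; apply: smooth_sum => a _; exact: smoothZ (smooth_iter_derive _ sf).
Qed.

Lemma test_in_diff_op M q f : test_in M f -> test_in M (diff_op q f).
Proof.
by move=> tf; apply: test_in_sum => a _; exact: test_inZ (test_in_iter_derive _ tf).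
Qed.

Lemma derive_smoothD u f g : smooth f -> smooth g -> 'D_u (f + g) = 'D_u f + 'D_u g.
Proof.
move=> sf sg; apply/funext => x.
exact: (deriveD (derivable_smooth (u := u) (x := x) sf) (derivable_smooth sg)).
Qed.

Lemma derive_smoothZ u (c : R) f : smooth f -> 'D_u (c *: f) = c *: 'D_u f.
Proof.
by move=> sf; apply/funext => x; exact: (deriveZ _ (derivable_smooth (u := u) (x := x) sf)).
Qed.

Lemma diff_opXM j q f : smooth f ->
  diff_op (mpolyX R (mnm1 j) * q) f = 'D_((row j U)^T) (diff_op q f).
Proof.
move=> sf; move: q; apply: mpoly_ind_monom => [a|q r IHq IHr|c q IH].
- rewrite -mpolyXD !diff_opX.
  have E : perm_eq (monomial_dirs U (mnm_add (mnm1 j) a)) ((row j U)^T :: monomial_dirs U a).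
    have e : monomial_dirs U (mnm1 j) = [:: (row j U)^T].
      rewrite /monomial_dirs (_ : flatten _ = [seq (row i U)^T | i <- enum 'I_m & i == j]).
        by rewrite (@filter_pred1_uniq _ _ j) ?enum_uniq ?mem_enum.
      elim: (enum _) => //= i r ->; rewrite mnm1E eq_sym; by case: (i == j).
    by rewrite -cat1s -e; apply: monomial_dirs_add => i; rewrite mnmDE.
  by rewrite (iter_derive_perm sf E).
- rewrite mulrDr !diff_opD IHq IHr.
  exact/esym/(derive_smoothD _ (smooth_diff_op q sf) (smooth_diff_op r sf)).
- rewrite -scalerAr !diff_opZ IH.
  exact/esym/(derive_smoothZ _ _ (smooth_diff_op q sf)).
Qed.

(** Since polynomials commute, so do these operators; this is what later allows exchanging an
    operator with its adjoint. *)
Lemma diff_opM q r f : smooth f -> diff_op (q * r) f = diff_op q (diff_op r f).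
Proof.
move=> sf; move: q; apply: mpoly_ind_mul => [|q s IHq IHs|c q IH|j q IH].
- by rewrite mul1r diff_op1.
- by rewrite mulrDl !diff_opD IHq IHs.
- by rewrite -scalerAl !diff_opZ IH.
- by rewrite -mulrA (diff_opXM j _ sf) IH (diff_opXM j _ (smooth_diff_op r sf)).
Qed.

End Directions.

Section Coordinates.
Implicit Types (q r : mpoly n R).

(* The rows of [1%:M] are the coordinate directions. *)
Local Notation dop := (diff_op (1%:M : 'M[R]_n)).

Lemma dopXM i q f : smooth f -> dop (mpolyX R (mnm1 i) * q) f = partial i (dop q f).
Proof.
move=> sf; rewrite (diff_opXM _ i q sf) /partial.
rewrite (_ : (row i 1%:M)^T = delta_mx i ord0)//.
by apply/matrixP => j k; rewrite (ord1 k) !mxE eqxx andbT eq_sym.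
Qed.

Definition coord_fun j : 'cV[R]_n -> R := fun x => x j ord0.

(** The commutator of q(d) with multiplication by x_j is the operator whose symbol is the j-th
    partial derivative of q. *)
Lemma dop_coord j q f : smooth f ->
  dop q (coord_fun j * f) = coord_fun j * dop q f + dop (mderiv j q) f.
Proof.
move=> sf; have sc : smooth (coord_fun j) by exact: smooth_coord.
have scf := smoothM sc sf.
move: q; apply: mpoly_ind_mul => [|q s IHq IHs|c q IH|i q IH].
- by rewrite !diff_op1 -mpolyC1 mderivC diff_op0 addr0.
- by rewrite mderivD !diff_opD IHq IHs mulrDr addrACA.
- rewrite mderivZ !diff_opZ IH scalerDr; congr (_ + _).
  by apply/funext => x; exact: mulrCA.
have sq := smooth_diff_op 1%:M q sf; have sdq := smooth_diff_op 1%:M (mderiv j q) sf.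
rewrite (dopXM _ _ scf) IH (partialD i (smoothM sc sq) sdq) (partialM i sc sq).
rewrite (dopXM i q sf) mderivM diff_opD (dopXM i _ sf) addrA; congr (_ + _ + _).
rewrite /coord_fun partial_coord mderiv_var mul_mpolyC diff_opZ.
by apply/funext => x; exact: mulrC.
Qed.

End Coordinates.
End DiffOp.

(** * Injectivity of constant coefficient operators *)

Section Injectivity.
Context {R : realType} {n : nat}.
Implicit Types (f g h : 'cV[R]_n -> R) (q r : mpoly n R).

Local Notation dop := (diff_op (1%:M : 'M[R]_n)).

Context (M : R).
Hypothesis M0 : 0 < M.
Local Notation L := (M + 1).

Let ML : M < L. Proof. by rewrite ltrDl. Qed.
Let L0 : 0 < L. Proof. exact: lt_trans ML. Qed.

Lemma null_mean0 : null_mean L (0 : 'cV[R]_n -> R).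
Proof.
rewrite /null_mean (_ : (fun _ => _) = cst 0); first exact: cvg_cst.
by apply/funext => N; rewrite /lattice_mean big1 ?mulr0.
Qed.

Lemma null_meanB f g : null_mean L f -> null_mean L g -> null_mean L (f - g).
Proof. by move=> nf ng; rewrite -scaleN1r; exact: null_meanD nf (null_meanZ _ ng). Qed.

(** Integration by parts. The witness built by the induction is q(-X); what matters is that the
    adjoint is again a constant coefficient operator, independent of [f] and [g]. *)
Lemma dop_adjoint q : exists q', forall f g, test_in M f -> test_in M g ->
  null_mean L (dop q f * g - f * dop q' g).
Proof.
move: q; apply: mpoly_ind_mul => [|q s [q' IHq] [s' IHs]|c q [q' IH]|i q [q' IH]].
- exists 1 => f g _ _; rewrite !diff_op1 subrr; exact: null_mean0.
- exists (q' + s') => f g tf tg; rewrite !diff_opD mulrDl mulrDr opprD addrACA.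
  exact: null_meanD (IHq f g tf tg) (IHs f g tf tg).
- exists (c *: q') => f g tf tg; rewrite !diff_opZ.
  rewrite (_ : _ - _ = c *: (dop q f * g - f * dop q' g)); last first.
    apply/funext => x; rewrite !fctE /GRing.scale /=; ring.
  exact: null_meanZ (IH f g tf tg).
exists (- (q' * mpolyX R (mnm1 i))) => f g tf tg.
have tF := test_in_diff_op 1%:M q tf; have tdg := test_in_derive (delta_mx i ord0) tg.
have E : dop (- (q' * mpolyX R (mnm1 i))) g = (-1) *: dop q' (partial i g).
  rewrite -scaleN1r diff_opZ (diff_opM _ _ _ tg.1); congr (_ *: dop q' _).
  by rewrite -[mpolyX _ _]mulr1 (dopXM i _ tg.1) diff_op1.
rewrite (dopXM i _ tf.1) E.
have := null_meanB (null_mean_partial L0 i ML (test_inMr tF tg.1)) (IH f _ tf tdg).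
rewrite (partialM i tF.1 tg.1); congr (null_mean _ _).
apply/funext => x; rewrite !fctE /GRing.scale /=; ring.
Qed.

Lemma null_sqr_eq0 f : test_in M f -> null_mean L (f * f) -> f = 0.
Proof.
move=> tf nf; have tff := test_inMr tf tf.1.
have /(_ nf) E := null_mean_eq0 L0 ML (test_in_continuous tff) tff.2 (fun x => sqr_ge0 (f x)).
apply/funext => x; have := congr1 (fun F => F x) E.
by move=> /eqP; rewrite /= mulf_eq0 orbb => /eqP.
Qed.

(* Constant coefficient operators are normal for the [L^2] product. If
   [q(d) h = 0] then the adjoint also kills [h], and pairing the identity
   [q'(d) h = q(d) (x_j h) - x_j q(d) h] (with [q'] the derivative of [q] in the
   [j]-th variable) with [q'(d) h] yields [q'(d) h = 0]. *)
Lemma dop_mderiv_eq0 q j h : test_in M h -> dop q h = 0 -> dop (mderiv j q) h = 0.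
Proof.
move=> th qh; have [q' adj] := dop_adjoint q.
have t's := test_in_diff_op 1%:M q' th.
have q'h : dop q' h = 0.
  apply: null_sqr_eq0; first exact: t's.
  (* Here [q'] is the adjoint symbol: the square of [dop q' h] pairs to the same value as
     [dop q (dop q' h)] against [h], and the former operator commutes with [dop q], which kills
     [h]. *)
  have := null_meanB null_mean0 (adj _ _ t's th).
  rewrite -(diff_opM _ _ _ th.1) (mulrC q) (diff_opM _ _ _ th.1) qh.
  by rewrite diff_op_0r mul0r sub0r opprB subr0.
have trh := test_in_diff_op 1%:M (mderiv j q) th.
have txh : test_in M (coord_fun j * h) by apply: test_inMl; [exact: smooth_coord|exact: th].
apply: null_sqr_eq0; first exact: trh.
have := adj _ _ txh trh.
rewrite (dop_coord j q th.1) qh mulr0 add0r -(diff_opM _ _ _ th.1) (mulrC q').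
rewrite (diff_opM _ _ _ th.1).
by rewrite q'h diff_op_0r mulr0 subr0.
Qed.

Lemma dop_inj q h : q != 0 -> test_in M h -> dop q h = 0 -> h = 0.
Proof.
move=> q0 th; move: q q0; apply: mpoly_ind_deriv => [c c0|i q IH] qh.
  have : c *: h = 0 by rewrite -(diff_opC (1%:M : 'M[R]_n)).
  move=> ch; apply/funext => x; have /eqP := congr1 (fun F => F x) ch.
  by rewrite -[(c *: h) x]/(c * h x) mulf_eq0 (negPf c0) => /eqP.
exact/IH/dop_mderiv_eq0.
Qed.

End Injectivity.

(** * Polynomial functions and linear substitution *)

Section Evaluation.
Context {R : realType} {n : nat}.
Implicit Types (q r : mpoly n R).

Lemma eval_atXM i q : eval_at (mpolyX R (mnm1 i) * q) = coord_fun i * eval_at q.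
Proof. by apply/funext => x; rewrite /eval_at mevalM mevalXU. Qed.

Lemma eval_atD q r : eval_at (q + r) = eval_at q + eval_at r.
Proof. by apply/funext => x; rewrite /eval_at mevalD. Qed.

Lemma eval_atZ (c : R) q : eval_at (c *: q) = c *: eval_at q.
Proof. by apply/funext => x; rewrite /eval_at mevalZ. Qed.

Lemma eval_at1 : eval_at (1 : mpoly n R) = cst 1.
Proof. by apply/funext => x; rewrite /eval_at meval1. Qed.

Lemma smooth_eval_at q : smooth (eval_at q).
Proof.
move: q; apply: mpoly_ind_mul => [|q r IHq IHr|c q IH|i q IH].
- rewrite eval_at1; exact: smooth_cst.
- rewrite eval_atD; exact: smoothD.
- rewrite eval_atZ; exact: smoothZ.
- rewrite eval_atXM; apply: smoothM IH; exact: smooth_coord.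
Qed.

Lemma partial_eval_at j q : partial j (eval_at q) = eval_at (mderiv j q).
Proof.
move: q; apply: mpoly_ind_mul => [|q r IHq IHr|c q IH|i q IH].
- rewrite -mpolyC1 mderivC mpolyC1 eval_at1; apply/funext => x.
  by rewrite /partial derive_cst /eval_at meval0.
- by rewrite mderivD !eval_atD (partialD j (smooth_eval_at q) (smooth_eval_at r)) IHq IHr.
- by rewrite mderivZ !eval_atZ (partialZ j c (smooth_eval_at q)) IH.
- rewrite mderivM eval_atD !eval_atXM mderiv_var.
  rewrite (partialM j (smooth_coord i) (smooth_eval_at q)) IH addrC; congr (_ + _).
  apply/funext => x; rewrite /coord_fun partial_coord mul_mpolyC eval_atZ eq_sym.
  exact: mulrC.
Qed.

(** Vanishing of the function passes to all partial derivatives, hence to the nonzero constant that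
    a nonzero polynomial would reach. *)
Lemma eval_at_eq0 q : (forall x, eval_at q x = 0) -> q = 0.
Proof.
move=> q0; apply/eqP; apply: contrapT => /negP qn0; move: q qn0 q0.
apply: mpoly_ind_deriv => [c c0 /(_ 0)|i q IH q0].
  by rewrite /eval_at mevalC => E; rewrite E eqxx in c0.
apply: IH => x; rewrite -partial_eval_at.
by rewrite (_ : eval_at q = 0) ?partial0//; apply/funext => y; exact: q0.
Qed.

Context {m : nat} (U : 'M[R]_(m, n)).

Definition linear_subst (q : mpoly m R) : mpoly n R :=
  comp_mpoly [tuple \sum_i U j i *: mpolyX R (mnm1 i) | j < m] q.

Lemma eval_linear_subst (q : mpoly m R) x : eval_at (linear_subst q) x = eval_at q (U *m x).
Proof.
rewrite /eval_at comp_mpoly_meval; apply: meval_eq => j.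
rewrite tnth_mktuple mxE raddf_sum /=; apply: eq_bigr => i _.
by rewrite mevalZ mevalXU.
Qed.

(** Derivation along row j of [U] is the sum of the U_ji d_i. Passing to coordinates matters because
    the m directions may be dependent: injectivity is governed by the symbol as a polynomial in n
    variables. *)
Lemma diff_op_linear_subst (q : mpoly m R) (f : 'cV[R]_n -> R) : smooth f ->
  diff_op U q f = diff_op 1%:M (linear_subst q) f.
Proof.
move=> sf; move: q; apply: mpoly_ind_mul => [|q r IHq IHr|c q IH|j q IH].
- by rewrite /linear_subst comp_mpoly1 !diff_op1.
- by rewrite /linear_subst comp_mpolyD !diff_opD IHq IHr.
- by rewrite /linear_subst comp_mpolyZ !diff_opZ IH.
have sq := smooth_diff_op 1%:M (linear_subst q) sf.
rewrite (diff_opXM U j q sf) IH (derive_smooth _ sq).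
rewrite /linear_subst rmorphM /= comp_mpolyXU -tnth_nth tnth_mktuple.
rewrite mulr_suml [RHS]diff_op_sum; apply: eq_bigr => i _.
by rewrite -scalerAl diff_opZ (dopXM i _ sf) !mxE.
Qed.

End Evaluation.

(** * The criterion, its projective form, and equality of images *)

Section Main.
Context {R : realType}.

Lemma star_reciprocal (m n : nat) (M : R) (p : mpoly m R) (U : 'M[R]_(m, n)) g :
  (forall j, row j U != 0) -> 0 < M -> test_in M g ->
  star p U (iter_derive (monomial_dirs U (degrees p)) g) =
  diff_op 1%:M (linear_subst U (reciprocal p)) g.
Proof.
move=> U0 M0 tg; rewrite (star_iter_derive p U0 M0 tg).
rewrite -(diff_op_linear_subst U _ tg.1) /reciprocal diff_op_sum.
by apply: eq_bigr => a _; rewrite diff_opZ diff_opX.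
Qed.

Lemma non_invertibleP (m n : nat) (p : mpoly m R) (U : 'M[R]_(m, n)) :
  (forall j, row j U != 0) -> realizable p U ->
  non_invertible p U <-> image_mx U `<=` zero_locus (reciprocal p).
Proof.
move=> U0 rp; split=> [ninv|imU].
  apply: contrapT => nim; apply: ninv.
  have Q0 : linear_subst U (reciprocal p) != 0.
    apply/eqP => Q0; apply: nim => _ [x _ <-].
    by rewrite /zero_locus /= -eval_linear_subst Q0 /eval_at meval0.
  move=> f g; rewrite !inE => tf tg Sfg.
  have tNg := test_functionZ (-1) tg.
  have /test_functionP[M M0 th] := test_functionD tf tNg.
  have Sh : star p U (f + (-1) *: g) = 0.
    by rewrite (starD rp tf tNg) (starZ _ rp tg) Sfg scaleN1r subrr.
  (* The difference of [f] and [g] lies in the kernel, hence so does its derivative of exponents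
     d_j, on which S acts as a differential operator with nonzero symbol. *)
  have := star_iter_derive_eq0 (monomial_dirs U (degrees p)) rp (test_functionD tf tNg) Sh.
  rewrite (star_reciprocal p U0 M0 th) => /(dop_inj M0 Q0 th).
  by rewrite scaleN1r => /eqP; rewrite subr_eq0 => /eqP.
have Q0 : linear_subst U (reciprocal p) = 0.
  apply: eval_at_eq0 => x; rewrite eval_linear_subst; apply: imU.
  by exists x.
(* Radius 0 and height 1: the bump only has to be nonzero at the origin. *)
have [g [/test_functionP[M M0 tg] _ g1]] := @bump_exists R n 0 1 (lexx 0) ler01.
pose s := monomial_dirs U (degrees p).
have tf : test_function R n (iter_derive s g).
  by apply/test_functionP; exists M; [exact: M0|exact: test_in_iter_derive].
have t0 : test_function R n 0.
  by apply/test_functionP; exists M; [exact: M0|exact: test_in0].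
move=> inj; have f0 : iter_derive s g = 0.
  apply: inj; rewrite ?inE//.
  by rewrite (star_reciprocal p U0 M0 tg) Q0 diff_op0 star0.
have := iter_beam_derive M0 tg (monomial_dirs_neq0 (degrees p) U0).
rewrite -/s f0 iter_beam0 => g0.
have := g1 0; rewrite normr0 lexx => /(_ isT).
by rewrite -g0 /= ler10.
Qed.

(* [0] lies in every linear subspace but is not seen projectively; it is reached
   by continuity along a line. *)
Lemma eval_at_line0 (m : nat) (q : mpoly m R) (y : 'cV[R]_m) :
  (forall t : R, t != 0 -> eval_at q (t *: y) = 0) -> eval_at q 0 = 0.
Proof.
move=> H.
have F1 : eval_at q ((@harmonic R k) *: y) @[k --> \oo] --> eval_at q 0.
  have c0 : (@harmonic R k) *: y @[k --> \oo] --> (0 : 'cV[R]_m).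
    by have := @cvgZr_tmp _ _ _ _ _ _ _ y (@cvg_harmonic R); rewrite scale0r; exact.
  have cq : continuous (eval_at q) := smooth_continuous (smooth_eval_at q).
  exact: (cvg_comp _ _ c0 (cq 0)).
rewrite -(cvg_lim (@Rhausdorff R) F1).
rewrite (_ : (fun k => _) = cst 0) ?lim_cst//.
by apply/funext => k; apply: H; rewrite /harmonic invr_eq0 pnatr_eq0.
Qed.

(** A nonzero row yields a nonzero vector of the image, hence a projective point and a line through
    0 along which 0 is reached. A zero image would make the projective inclusion vacuous. *)
Lemma proj_linear_subset (m n : nat) (q : mpoly m R) (U : 'M[R]_(m, n)) :
  (0 < m)%N -> (forall j, row j U != 0) ->
  proj_linear (image_mx U) `<=` proj_zero_locus q <->
  image_mx U `<=` zero_locus q.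
Proof.
move=> m0 U0; split=> [PU|UV L LU y yL _]; last by apply: UV; exact: LU.
have neq0 y : image_mx U y -> y != 0 -> eval_at q y = 0.
  move=> [x _ <-] y0.
  have dL : \dim <[U *m x]>%VS = 1%N by rewrite dim_vline y0.
  apply: (PU (exist _ <[U *m x]>%VS dL)) => //=; last exact: memv_line.
  by move=> z /= /vlineP[k ->]; exists (k *: x); rewrite ?linearZ.
move=> y Uy; rewrite /zero_locus /=.
have [->|] := eqVneq y 0; last exact: neq0.
have [i Ui] : exists i, U (Ordinal m0) i != 0.
  by have /rV0Pn[i] := U0 (Ordinal m0); rewrite mxE; exists i.
apply: (@eval_at_line0 _ q (U *m delta_mx i ord0)) => t t0; apply: neq0.
  by exists (t *: delta_mx i ord0); rewrite ?linearZ.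
rewrite scaler_eq0 negb_or t0 /= -colE; apply/eqP => /matrixP /(_ (Ordinal m0) ord0).
by rewrite !mxE => /eqP; rewrite (negPf Ui).
Qed.

Lemma image_mx_sub (m n : nat) (U V : 'M[R]_(m, n)) :
  image_mx V `<=` image_mx U -> exists f : 'M[R]_n, V = U *m f.
Proof.
move=> VU; have /choice[y yP] : forall j, exists y : 'cV[R]_n, U *m y = col j V.
  move=> j; have [|y _ Uy] := VU (col j V); first by exists (delta_mx j ord0); rewrite ?colE.
  by exists y.
exists (\matrix_(i, j) y j i ord0); apply/matrixP => i j.
have := congr1 (fun A : 'cV[R]_m => A i ord0) (yP j); rewrite !mxE => <-.
by apply: eq_bigr => k _; rewrite mxE.
Qed.

Lemma eq_image_mxP (m n : nat) (U V : 'M[R]_(m, n)) :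
  image_mx U = image_mx V <-> exists2 g : 'M[R]_n, g \in unitmx & V = U *m g.
Proof.
split=> [UV|[g gU ->]].
  have [f Vf] : exists f : 'M[R]_n, V = U *m f by apply: image_mx_sub; rewrite UV.
  have [f' Uf'] : exists f' : 'M[R]_n, U = V *m f' by apply: image_mx_sub; rewrite UV.
  (* The factor [f] may be singular, being determined only modulo the kernel of [U]; equality of
     ranks provides an invertible [g] with the same product. *)
  have rk : \rank (U *m f) = \rank U.
    by apply/eqP; rewrite eqn_leq mxrankM_maxl/= -Vf {1}Uf' mxrankM_maxl.
  have [g gU Ug] := complete_unitmx rk.
  by exists g; rewrite // Vf.
apply/seteqP; split=> _ [x _ <-].
  by exists (invmx g *m x) => //; rewrite -mulmxA mulKVmx.
by exists (g *m x) => //; rewrite mulmxA.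
Qed.

End Main.

Theorem theorem5p1 (R : realType) (m n : nat) (p : mpoly m R) :
  (forall U : 'M[R]_(m, n),
     (forall j, row j U != 0) ->
     realizable p U ->
     (non_invertible p U <-> image_mx U `<=` zero_locus (reciprocal p))
     /\
     ((0 < m)%N -> forall d : nat, p \is ishomog1 d mdeg ->
        (non_invertible p U <->
         proj_linear (image_mx U) `<=` proj_zero_locus (reciprocal p))))
  /\
  (forall U U' : 'M[R]_(m, n),
     (forall j, row j U != 0) -> (forall j, row j U' != 0) ->
     (image_mx U = image_mx U' <->
      exists2 g : 'M[R]_n, g \in unitmx & U' = U *m g)).
Proof.
split=> [U U0 rp|U U' _ _]; last exact: eq_image_mxP.
have E := non_invertibleP U0 rp; split; first exact: E.
by move=> m0 d _; exact: (iff_trans E (iff_sym (proj_linear_subset (reciprocal p) m0 U0))).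
Qed.
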